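(* Let $k\ge1$ and let $L$ be the vertex set of the semi-infinite Cayley tree $\Gamma^k(x_0)=(L,E)$ of order $k$ with root $x_0$. Let $\{K_{<x,y>}\in\mathcal B_{\{x,y\}}\}_{\{x,y\}\in E}$ be a family of operators and let $w_0\in\mathcal B_{x_0}$ and $h_x\in\mathcal B_x$ ($x\in L$) be positive operators satisfying $$\mathrm{Tr}(w_0h_{x_0})=1,$$ $$\mathrm{Tr}_x\Big(\prod_{i=1}^kK_{<x,(x,i)>}\ \prod_{i=1}^kh_{(x,i)}\ \prod_{i=1}^kK^*_{<x,(x,k+1-i)>}\Big)=h_x\qquad\text{for every }x\in L.$$ Then the functionals $\{\varphi^{(n)}\}_{n\ge0}$, $\varphi^{(n)}(a)=\mathrm{Tr}\big(\mathcal W_{n+1]}(a\otimes\mathbf 1_{W_{n+1}})\big)$ for $a\in\mathcal B_{\Lambda_n}$, satisfy the compatibility condition $$\varphi^{(n+1)}\big|_{\mathcal B_{\Lambda_n}}=\varphi^{(n)}.$$ Moreover, there is a unique state $\varphi$ on $\mathcal B_L$ such that $\varphi=\mathrm{w}\text{-}\lim_{n\to\infty}\varphi^{(n)}$.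
   Context: Tree: the semi-infinite Cayley tree $\Gamma^k(x_0)$ of order $k$ is the infinite rooted tree in which every vertex (including the root) has exactly $k$ direct successors. Its vertices are coordinatized by finite words $(i_1,\dots,i_n)$, $i_m\in\{1,\dots,k\}$, the root $x_0$ being the empty word; the direct successors of $x=(i_1,\dots,i_n)$ are $(x,i)=(i_1,\dots,i_n,i)$, $1\le i\le k$, and $E$ consists of the edges $\{x,(x,i)\}$. For an edge, $<x,y>$ is written with $y$ the direct successor of $x$. $W_n$ is the set of vertices at distance $n$ from $x_0$, $\Lambda_n=\bigcup_{m=0}^nW_m$, and $E_n$ is the set of edges with both endpoints in $\Lambda_n$. Algebras: to each $x\in L$ is associated $\mathcal B_x=\mathcal B(\mathcal H_x)$ with $\dim\mathcal H_x=d<\infty$ independent of $x$; $\mathcal B_\Lambda=\bigotimes_{x\in\Lambda}\mathcal B_x$ for finite $\Lambda$, identified with $\mathcal B_\Lambda\otimes I$ in larger algebras, and $\mathcal B_L$ is the $C^*$-inductive limit. $\mathrm{Tr}$ is the normalized trace on $\mathcal B_L$, $\mathrm{Tr}_\Lambda:\mathcal B_L\to\mathcal B_\Lambda$ is the normalized partial trace, and $\mathrm{Tr}_x=\mathrm{Tr}_{\{x\}}$. $\mathbf 1_{W_n}=\bigotimes_{y\in W_n}\mathbf 1$. All products $\prod_{i=1}^k$ are ordered from left to right with increasing $i$. Put $$\prod_{\{x,y\}\in E_m\setminus E_{m-1}}K_{<x,y>}:=\prod_{x\in W_{m-1}}\prod_{i=1}^kK_{<x,(x,i)>}$$ (the factors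 for different $x\in W_{m-1}$ commute; $E_0=\emptyset$), and for $n\ge1$ $$K_n=w_0^{1/2}\prod_{\{x,y\}\in E_1}K_{<x,y>}\prod_{\{x,y\}\in E_2\setminus E_1}K_{<x,y>}\cdots\prod_{\{x,y\}\in E_n\setminus E_{n-1}}K_{<x,y>}\prod_{x\in W_n}h_x^{1/2},\qquad \mathcal W_{n]}=K_n^*K_n.$$ The statement $\varphi=\mathrm{w}\text{-}\lim\varphi^{(n)}$ means $\varphi(a)=\lim_{n\to\infty}\varphi^{(n)}(a)$ for every $a\in\bigcup_m\mathcal B_{\Lambda_m}$ (with $\varphi^{(n)}(a)$ defined as soon as $a\in\mathcal B_{\Lambda_n}$). *)

(* Defs.v *)
From HB Require Import structures.
From mathcomp Require Import all_boot all_order all_algebra finmap.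
From mathcomp Require Import sesquilinear spectral complex.
From mathcomp Require Import all_classical all_reals.
From mathcomp Require Import topology normedtype sequences.

Set Implicit Arguments.
Unset Strict Implicit.
Unset Printing Implicit Defensive.

Import Order.TTheory GRing.Theory Num.Theory.
Import numFieldNormedType.Exports.

Local Open Scope classical_set_scope.
Local Open Scope fset_scope.
Local Open Scope complex_scope.
Local Open Scope sesquilinear_scope.
Local Open Scope ring_scope.

(* Vertices are finite words; the direct successors of x are the words
   rcons x i, so that the edges {x, (x, i)} are indexed by the pairs (x, i). *)
Definition vertex (k : nat) : Type := seq 'I_k.
HB.instance Definition _ k := Choice.on (vertex k).

Definition x0 (k : nat) : vertex k := [::].

Definition child (k : nat) (x : vertex k) (i : 'I_k) : vertex k := rcons x i.

(* The vertices at distance n from the root. *)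
Definition W (k n : nat) : seq (vertex k) :=
  [seq tval w | w <- enum {: n.-tuple 'I_k}].

Definition Lambda (k n : nat) : {fset vertex k} :=
  [fset x in flatten [seq W k m | m <- iota 0 n.+1]].

Definition edge (k : nat) (x : vertex k) (i : 'I_k) : {fset vertex k} :=
  [fset x; child x i].

Definition succ_nbhd (k : nat) (x : vertex k) : {fset vertex k} :=
  x |` [fset y in [seq child x i | i <- enum 'I_k]].

(* B_X = B(H)^{(x) X} with H = C^(d+1) is the algebra of matrices indexed by the
   configurations X -> 'I_d.+1, i.e. by the product basis of H^{(x) X}; writing
   the dimension as d.+1 only says that it is at least 1. *)
Definition conf (d k : nat) (X : {fset vertex k}) : finType :=
  {ffun X -> 'I_d.+1}.

Definition op (R : realType) (d k : nat) (X : {fset vertex k}) : Type :=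
  'M[R[i]]_#|conf d X|.

Section LocalAlgebras.
Variables (R : realType) (d k : nat).
Implicit Types X Y : {fset vertex k}.

Definition entry X (a : op R d X) (s t : conf d X) : R[i] :=
  a (enum_rank s) (enum_rank t).

Definition op_of X (f : conf d X -> conf d X -> R[i]) : op R d X :=
  \matrix_(i, j) f (enum_val i) (enum_val j).

(* The default value ord0 is never used when X `<=` Y. *)
Definition restr X Y (s : conf d Y) : conf d X :=
  [ffun x : X => oapp s ord0 (insub (val x))].

Definition agree_off X Y (s t : conf d Y) : bool :=
  [forall y : Y, (val y \notin X) ==> (s y == t y)].

(* For X `<=` Y, the inclusion of B_X in B_Y, a |-> a (x) 1_(Y \ X). *)
Definition embed X Y (a : op R d X) : op R d Y :=
  op_of (fun s t : conf d Y =>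
    if agree_off X s t then entry a (restr X s) (restr X t) else 0).

Definition ntr X (a : op R d X) : R[i] := \tr a / #|conf d X|%:R.

(* For X `<=` Y, the normalized partial trace B_Y -> B_X. The sum is the trace
   over Y \ X, whose dimension is #|conf d Y| / #|conf d X|. *)
Definition ptr X Y (a : op R d Y) : op R d X :=
  op_of (fun s t : conf d X =>
    #|conf d X|%:R / #|conf d Y|%:R *
    \sum_(p : conf d Y * conf d Y |
            [&& restr X p.1 == s, restr X p.2 == t & agree_off X p.1 p.2])
       entry a p.1 p.2).

Definition adj X (a : op R d X) : op R d X := a ^t*.

Definition positive_op X (a : op R d X) : Prop :=
  forall u : 'rV[R[i]]_#|conf d X|, 0 <= dotmx (u *m a) u.

(* Functional calculus: a = P^-1 D P with P unitary and D diagonal whenever a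
   is normal, in particular for a positive. *)
Definition sqrt_op X (a : op R d X) : op R d X :=
  invmx (spectralmx a) *m diag_mx (map_mx sqrtC (spectral_diag a))
    *m spectralmx a.

End LocalAlgebras.

Section QuantumMarkovChain.
Variables (R : realType) (d k : nat).
Variable K : forall (x : vertex k) (i : 'I_k), op R d (edge x i).
Variable w0 : op R d [fset x0 k].
Variable h : forall x : vertex k, op R d [fset x].

Definition consistent (x : vertex k) : Prop :=
  let emb X (a : op R d X) := embed (succ_nbhd x) a in
  ptr [fset x]
    ((\prod_(i < k) emb _ (K x i)) *
     (\prod_(i < k) emb _ (h (child x i))) *
     (\prod_(i < k) adj (emb _ (K x (rev_ord i))))) = h x.

Definition Kprod (n : nat) : op R d (Lambda k n) :=
  let emb X (a : op R d X) := embed (Lambda k n) a in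
  emb _ (sqrt_op w0) *
  (\prod_(m < n) \prod_(x <- W k m) \prod_(i < k) emb _ (K x i)) *
  (\prod_(x <- W k n) emb _ (sqrt_op (h x))).

Definition Wop (n : nat) : op R d (Lambda k n) := adj (Kprod n) * Kprod n.

Definition phin (n : nat) (a : op R d (Lambda k n)) : R[i] :=
  ntr (Wop n.+1 * embed (Lambda k n.+1) a).

End QuantumMarkovChain.

(* Unital C*-algebras. *)
Record cstarAlgebra (R : realType) := CStarAlgebra {
  carrier :> algType R[i];
  cnorm : carrier -> R;
  star : carrier -> carrier;
  cnorm0_eq0 : forall a, cnorm a = 0 -> a = 0;
  cnormD : forall a b, cnorm (a + b) <= cnorm a + cnorm b;
  cnormZ : forall (c : R[i]) a, (cnorm (c *: a))%:C = `|c| * (cnorm a)%:C;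
  cnormM : forall a b, cnorm (a * b) <= cnorm a * cnorm b;
  cnorm_complete : forall u : nat -> carrier,
    (forall e : R, 0 < e -> exists N, forall m n,
       (N <= m)%N -> (N <= n)%N -> cnorm (u m - u n) < e) ->
    exists a, (fun n => cnorm (u n - a)) @ \oo --> (0 : R);
  starK : forall a, star (star a) = a;
  starD : forall a b, star (a + b) = star a + star b;
  starZ : forall (c : R[i]) a, star (c *: a) = c^* *: star a;
  starM : forall a b, star (a * b) = star b * star a;
  cstar_identity : forall a, cnorm (star a * a) = cnorm a ^+ 2 }.

(* B, with the embeddings iota X, is the C*-inductive limit of the B_X over the
   finite X: the iota X are compatible injective (hence isometric) unital
   *-homomorphisms, and the union of their ranges is dense. This determines
   (B, iota) up to a unique isomorphism. *)
Record is_cstar_limit (R : realType) (d k : nat) (B : cstarAlgebra R)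
    (iota : forall X : {fset vertex k}, op R d X -> B) : Prop := IsCStarLimit {
  iota_linear : forall X, linear (iota X);
  iota1 : forall X, iota X 1 = 1;
  iotaM : forall X a b, iota X (a * b) = iota X a * iota X b;
  iota_adj : forall X a, iota X (adj a) = star (iota X a);
  iota_inj : forall X, injective (iota X);
  iota_embed : forall X Y a, X `<=` Y -> iota Y (embed Y a) = iota X a;
  iota_dense : forall (b : B) (e : R), 0 < e ->
    exists X a, cnorm (b - iota X a) < e }.

Definition is_state (R : realType) (B : cstarAlgebra R) (phi : B -> R[i]) : Prop :=
  [/\ scalar phi, forall a : B, 0 <= phi (star a * a) & phi 1 = 1].

(* f n is defined on B_(Lambda n); for a in B_(Lambda m) the limit is taken
   along the indices n >= m, where f n is applied to a seen in B_(Lambda n). *)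
Definition is_wlim (R : realType) (d k : nat) (B : cstarAlgebra R)
    (iota : forall X : {fset vertex k}, op R d X -> B)
    (f : forall n, op R d (Lambda k n) -> R[i]) (phi : B -> R[i]) : Prop :=
  forall m (a : op R d (Lambda k m)),
    (fun n => f (m + n)%N (embed (Lambda k (m + n)) a)) @ \oo
      --> (phi (iota _ a) : R[i]^o).

(* Main.v *)
Require Import Defs.
From HB Require Import structures.
From mathcomp Require Import all_boot all_order all_algebra finmap.
From mathcomp Require Import ring.
From mathcomp Require Import sesquilinear spectral complex.
From mathcomp Require Import all_classical all_reals.
From mathcomp Require Import topology normedtype sequences.

Set Implicit Arguments.
Unset Strict Implicit.
Unset Printing Implicit Defensive.

Import Order.TTheory GRing.Theory Num.Theory.
Import numFieldNormedType.Exports.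

Local Open Scope classical_set_scope.
Local Open Scope fset_scope.
Local Open Scope complex_scope.
Local Open Scope ring_scope.

(** The theorem has an algebraic and an analytic half.

    Compatibility. By cyclicity of the trace, [phi^(n) a] is the trace of
    [w_0 K_1 ... K_(n+1) a h_(n+1) K_(n+1)^* ... K_1^*], where [K_m] is the product of
    the [K_<x,y>] over the [m]-th layer of edges and [h_m] the product of the [h_x]
    over the [m]-th level: the square roots of the [h_x] commute with [a] and merge
    ([phin_chain_trace]). With one more layer, [a] commutes with [K_(n+2)], which
    therefore conjugates [h_(n+2)] only. This conjugate is a product over the vertices
    [x] of level [n+1] of commuting operators supported on [x] and its successors
    ([layer_conj]). Under the trace, each of them may be replaced by its partial trace
    to [x], because nothing else involves the successors of [x] ([ntr_mul_ptr]); the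
    consistency condition says that this partial trace is [h_x]
    ([ntr_vertex_blocks]), and what remains is [phi^(n) a]. The same collapse of the
    first layer gives [phi^(n) 1 = Tr (w_0 h_(x_0)) = 1] ([phin1]).

    The limit. Each [phi^(n)] is a state, since it has a density of the form [K^* K].
    A state on a local matrix algebra is bounded by the norm of the limit algebra:
    a hermitian matrix is a combination of its spectral projections, and each
    eigenvalue is bounded by the norm because the projections have nonzero image
    ([local_state_bound]). Being compatible, the [phi^(n)] define a Lipschitz function
    on a dense subspace; it extends by McShane's formula ([lipschitz_extension]), and
    linearity and positivity pass to the extension by density ([limit_state]).
    Conversely, any state of a C*-algebra is bounded, because [1 - x] is a square for
    every hermitian [x] of norm less than 1 ([one_minus_square], [state_bound]); so
    two states that agree with the [phi^(n)] on the dense subspace coincide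
    ([state_unique]). *)

(** * Configurations and partial traces *)

Section Configurations.
Variables (d k : nat).
Implicit Types D X Y Z : {fset vertex k}.

(** Reading a configuration as a total function on vertices, with value [ord0]
    outside its domain, turns every identity between restricted, patched and
    agreeing configurations into a case analysis on membership. *)
Definition cval X (s : conf d X) (v : vertex k) : 'I_d.+1 :=
  oapp s ord0 (insub v).

Definition mkconf Z (f : vertex k -> 'I_d.+1) : conf d Z := [ffun z => f (val z)].

Definition patch D Z (s : conf d Z) (w : vertex k -> 'I_d.+1) : conf d Z :=
  mkconf Z (fun v => if v \in D then w v else cval s v).

Lemma cval_in X (s : conf d X) (x : X) : cval s (val x) = s x.
Proof. by rewrite /cval valK. Qed.

Lemma cval_out X (s : conf d X) v : v \notin X -> cval s v = ord0.
Proof. by move=> vX; rewrite /cval insubN. Qed.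

Lemma cval_mk X f v : cval (mkconf X f) v = if v \in X then f v else ord0.
Proof.
case: ifPn => vX; last exact: cval_out.
by rewrite -[v]/(val [` vX]) cval_in ffunE.
Qed.

Lemma cvalP X (s t : conf d X) : {in X, cval s =1 cval t} -> s = t.
Proof. by move=> st; apply/ffunP => x; rewrite -!cval_in st ?fsvalP. Qed.

Lemma cval_restr X Y (s : conf d Y) v :
  cval (restr X s) v = if v \in X then cval s v else ord0.
Proof.
case: ifPn => vX; last exact: cval_out.
by rewrite -[v]/(val [` vX]) cval_in ffunE.
Qed.

Lemma cval_patch D Z (s : conf d Z) w v :
  cval (patch D s w) v =
  if v \in Z then (if v \in D then w v else cval s v) else ord0.
Proof. exact: cval_mk. Qed.

Lemma agree_offP X Y (s t : conf d Y) :
  reflect (forall v, v \notin X -> cval s v = cval t v) (agree_off X s t).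
Proof.
apply: (iffP forallP) => [st v vX | st y].
  have [vY|vY] := boolP (v \in Y); last by rewrite !cval_out.
  by move/implyP/(_ vX)/eqP: (st [` vY]); rewrite -!cval_in.
by apply/implyP => yX; rewrite -!cval_in st.
Qed.

Lemma agree_offC X Y (s t : conf d Y) : agree_off X s t = agree_off X t s.
Proof. by apply/agree_offP/agree_offP => st v /st. Qed.

Lemma agree_off_refl X Y (s : conf d Y) : agree_off X s s.
Proof. exact/agree_offP. Qed.

Lemma agree_off_trans X Y (s t u : conf d Y) :
  agree_off X s t -> agree_off X t u -> agree_off X s u.
Proof. by move=> /agree_offP st /agree_offP tu; apply/agree_offP => v vX; rewrite st ?tu. Qed.

Lemma patch_restr X Z (s w : conf d Z) : agree_off X s w ->
  patch X s (cval (restr X w)) = w.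
Proof.
move=> /agree_offP sw; apply: cvalP => v vZ; rewrite cval_patch vZ cval_restr.
by case: (boolP (v \in X)) => [//|/sw].
Qed.

Lemma restr_patch X Z (s : conf d Z) (w : conf d X) : X `<=` Z ->
  restr X (patch X s (cval w)) = w.
Proof.
move=> /fsubsetP XZ; apply: cvalP => v vX.
by rewrite cval_restr vX cval_patch XZ // vX.
Qed.

Lemma agree_off_patch X Z (s : conf d Z) w : agree_off X s (patch X s w).
Proof.
apply/agree_offP => v vX; rewrite cval_patch (negPf vX).
by case: ifPn => // /cval_out.
Qed.

Section Sums.
Variable V : nmodType.

(** A configuration agreeing with [s] off [X] is determined by its restriction
    to [X], which is arbitrary; so the sum over the intermediate index in a product
    of two embedded operators is a sum over [conf d X]. *)
Lemma sum_agree_off X Z (s : conf d Z) (F : conf d X -> V) : X `<=` Z ->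
  \sum_(u | agree_off X s u) F (restr X u) = \sum_w F w.
Proof.
move=> XZ; rewrite (reindex_onto (fun w : conf d X => patch X s (cval w))
                      (fun u => restr X u)) /=.
  apply: eq_big => [w|w _]; last by rewrite restr_patch.
  by rewrite agree_off_patch restr_patch ?eqxx.
by move=> u su; rewrite patch_restr.
Qed.

(** Exchanging the [X]-coordinates of [s] and [w] is an involution on pairs.
    The counting identities [sum_restr] and [sum_patch] are instances of it, which
    avoids computing the cardinality of any fibre. *)
Lemma sum_exchange X Z (F : conf d Z -> conf d X -> V) : X `<=` Z ->
  \sum_(s : conf d Z) \sum_(w : conf d X) F s w =
  \sum_(s : conf d Z) \sum_(w : conf d X) F (patch X s (cval w)) (restr X s).
Proof.
move=> XZ; rewrite !pair_bigA /=.
pose e (p : conf d Z * conf d X) := (patch X p.1 (cval p.2), restr X p.1).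
rewrite (reindex_inj (h := e)) //; apply: (can_inj (g := e)) => -[s w].
rewrite /e /= restr_patch //; congr pair.
apply: cvalP => v vZ; rewrite !cval_patch vZ cval_restr.
by case: ifP => // ->.
Qed.

Lemma sum_restr X Z (F : conf d X -> V) : X `<=` Z ->
  (\sum_(s : conf d Z) F (restr X s)) *+ #|conf d X| = (\sum_w F w) *+ #|conf d Z|.
Proof.
move=> XZ.
have := @sum_exchange X Z (fun _ w => F w) XZ.
rewrite sumr_const => ->; rewrite -sumrMnl; apply: eq_bigr => s _.
by rewrite sumr_const.
Qed.

Lemma sum_patch X Z (w : conf d X) (F : conf d Z -> V) : X `<=` Z ->
  \sum_(p : conf d Z) F (patch X p (cval w)) = (\sum_(p | restr X p == w) F p) *+ #|conf d X|.
Proof.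
move=> XZ.
have := @sum_exchange X Z (fun p v => if restr X p == w then F p else 0) XZ.
under eq_bigr do rewrite sumr_const.
rewrite sumrMnl -big_mkcond /= => ->; apply: eq_bigr => p _.
under eq_bigr do rewrite restr_patch //.
by rewrite -big_mkcond big_pred1_eq.
Qed.

(** Replacing the common [D]-coordinates of [s] and [t] by those of a third
    configuration [r] leaves the sum unchanged, again because exchanging these
    coordinates with [r] is an involution. Averaging over [r] is what produces the
    partial trace in [ntr_mul_ptr]. *)
Lemma sum_resample D Z (F : conf d Z -> conf d Z -> V) :
  (\sum_(s : conf d Z) \sum_(t | agree_off (Z `\` D) s t) F s t) *+ #|conf d Z| =
  \sum_(s : conf d Z) \sum_(t | agree_off (Z `\` D) s t)
     \sum_(r : conf d Z) F (patch D s (cval r)) (patch D t (cval r)).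
Proof.
rewrite !pair_big_dep /=.
rewrite -sumrMnl.
transitivity (\sum_(p : conf d Z * conf d Z | agree_off (Z `\` D) p.1 p.2)
    \sum_(r : conf d Z) F p.1 p.2).
  by apply: eq_bigr => p _; rewrite sumr_const.
rewrite pair_big_dep /=.
(* On triples whose first two entries agree on [D], [e] is an involution; on
   other triples [e (e q)] differs from [q]. *)
pose e (q : (conf d Z * conf d Z) * conf d Z) :=
  (patch D q.1.1 (cval q.2), patch D q.1.2 (cval q.2), patch D q.2 (cval q.1.1)).
rewrite (reindex_onto e e) /=; last first.
  move=> [[s t] r] /= /andP[/agree_offP st _].
  have E v : v \in Z -> v \in D -> cval s v = cval t v.
    by move=> vZ vD; apply: st; rewrite in_fsetD vD.
  rewrite /e /=; congr (_, _, _); apply: cvalP => v vZ; rewrite !cval_patch vZ;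
    case: (boolP (v \in D)) => vD //.
  by rewrite E.
apply: eq_bigl => -[[s t] r]; rewrite !andbT /e /=.
have [/agree_offP st|nst] := boolP (agree_off (Z `\` D) s t).
  have E v : v \in Z -> v \in D -> cval s v = cval t v.
    by move=> vZ vD; apply: st; rewrite in_fsetD vD.
  apply/andP; split.
    apply/agree_offP => v; rewrite in_fsetD negb_and negbK !cval_patch.
    by case: ifP => // vZ; rewrite orbF => ->.
  apply/eqP; congr (_, _, _); apply: cvalP => v vZ; rewrite !cval_patch vZ;
    case: (boolP (v \in D)) => vD //.
  by rewrite E.
apply/negbTE; apply: contra nst => /andP[_ /eqP[Es Et _]].
apply/agree_offP => v; rewrite in_fsetD negb_and negbK.
have [vZ|vZ] := boolP (v \in Z); last by rewrite !cval_out.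
by rewrite orbF => vD; rewrite -Es -Et !cval_patch vZ vD.
Qed.

End Sums.
End Configurations.

Section LocalOperators.
Variables (R : realType) (d k : nat).
Implicit Types X Y Z S : {fset vertex k}.
Local Notation op := (op R d).

Lemma entry_op_of X f s t : entry (op_of f : op X) s t = f s t.
Proof. by rewrite /entry mxE !enum_rankK. Qed.

Lemma entryP X (a b : op X) : (forall s t, entry a s t = entry b s t) -> a = b.
Proof.
move=> ab; apply/matrixP => i j.
by have := ab (enum_val i) (enum_val j); rewrite /entry !enum_valK.
Qed.

Lemma entry_embed X Y (a : op X) s t :
  entry (embed Y a) s t =
  if agree_off X s t then entry a (restr X s) (restr X t) else 0.
Proof. exact: entry_op_of. Qed.

Lemma entryM X (a b : op X) s t :
  entry (a * b) s t = \sum_u entry a s u * entry b u t.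
Proof.
rewrite /entry [a * b]/(a *m b) mxE (reindex (@enum_rank _)) //.
by apply: onW_bij; exact: enum_rank_bij.
Qed.

Lemma entry1 X s t : entry (1 : op X) s t = (s == t)%:R.
Proof. by rewrite /entry mxE (inj_eq enum_rank_inj). Qed.

Lemma entry_adj X (a : op X) s t : entry (adj a) s t = (entry a t s)^*.
Proof. by rewrite /entry !mxE. Qed.

Lemma mxtraceE X (a : op X) : \tr a = \sum_s entry a s s.
Proof.
rewrite /mxtrace (reindex (@enum_rank _)) //.
by apply: onW_bij; exact: enum_rank_bij.
Qed.

Lemma embedM X Z (a b : op X) : X `<=` Z ->
  embed Z (a * b) = embed Z a * embed Z b.
Proof.
move=> XZ; apply: entryP => s t; rewrite entry_embed !entryM.
under [RHS]eq_bigr do rewrite !entry_embed.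
case: ifPn => st; last first.
  rewrite big1 // => u _; case: ifPn => su; last by rewrite mul0r.
  case: ifPn => [ut|_]; last by rewrite mulr0.
  by rewrite (agree_off_trans su ut) in st.
rewrite -(sum_agree_off s (fun w => entry a (restr X s) w * entry b w (restr X t)) XZ).
rewrite big_mkcond; apply: eq_bigr => u _; case: ifPn => su; last by rewrite mul0r.
by rewrite ifT // (agree_off_trans _ st) // agree_offC.
Qed.

Lemma embed1 X Z : X `<=` Z -> embed Z (1 : op X) = 1.
Proof.
move=> /fsubsetP XZ; apply: entryP => s t; rewrite entry_embed !entry1.
have [->|st] := eqVneq s t; first by rewrite agree_off_refl eqxx.
case: ifP => // /agree_offP stX; case: eqP => // E; case/eqP: st.
apply: cvalP => v vZ; have [vX|/stX//] := boolP (v \in X).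
by have := congr1 (fun c => cval c v) E; rewrite !cval_restr vX.
Qed.

Lemma embedZ X Z c (a : op X) : embed Z (c *: a) = c *: embed Z a.
Proof.
apply: entryP => s t; rewrite {2}/entry mxE -!/(entry _ s t) !entry_embed.
by rewrite {1}/entry mxE; case: ifP => // _; rewrite mulr0.
Qed.

Lemma embedD X Z (a b : op X) : embed Z (a + b) = embed Z a + embed Z b.
Proof.
apply: entryP => s t; rewrite {2}/entry mxE -!/(entry _ s t) !entry_embed.
by rewrite {1}/entry mxE; case: ifP => // _; rewrite addr0.
Qed.

Lemma embed_adj X Z (a : op X) : embed Z (adj a) = adj (embed Z a).
Proof.
apply: entryP => s t; rewrite entry_adj !entry_embed entry_adj agree_offC.
by case: ifP; rewrite ?rmorph0.
Qed.

Lemma embed_embed X Y Z (a : op X) : X `<=` Y -> Y `<=` Z ->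
  embed Z (embed Y a) = embed Z a.
Proof.
move=> /fsubsetP XY /fsubsetP YZ; apply: entryP => s t; rewrite !entry_embed.
have RR (u : conf d Z) : restr X (restr Y u) = restr X u.
  by apply: cvalP => v vX; rewrite !cval_restr vX XY.
rewrite !RR.
case: ifP => [/agree_offP stY|/negP stY]; last first.
  case: ifP => // /agree_offP st; case: stY; apply/agree_offP => v vY.
  by apply: st; apply: contra vY => /XY.
congr (if _ then _ else _); apply/agree_offP/agree_offP => st v vX.
  have [vY|/stY//] := boolP (v \in Y).
  by have := st v vX; rewrite !cval_restr vY.
by rewrite !cval_restr; case: ifP => // _; apply: st.
Qed.

Lemma embed_id X (a : op X) : embed X a = a.
Proof.
apply: entryP => s t; rewrite entry_embed.
have E (u : conf d X) : restr X u = u by apply: cvalP => v vX; rewrite cval_restr vX.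
rewrite !E ifT //; apply/agree_offP => v vX; by rewrite !cval_out.
Qed.

(** The intermediate configuration must agree with [t] on [X] and with [s]
    elsewhere, so the sum in the matrix product has a single term. The resulting
    expression is symmetric in the two factors, whence [embed_comm]. *)
Lemma entry_embed_disjoint X Y Z (a : op X) (b : op Y) s t : X `<=` Z -> [disjoint X & Y] ->
  entry (embed Z a * embed Z b) s t =
  if agree_off (X `|` Y) s t then
    entry a (restr X s) (restr X t) * entry b (restr Y s) (restr Y t) else 0.
Proof.
move=> XZ /fdisjointP dXY; rewrite entryM.
pose u0 := patch X s (cval t).
rewrite (bigD1 u0) //= big1 ?addr0 => [|u neu]; last first.
  rewrite !entry_embed; case: ifPn => [/agree_offP su|_]; last by rewrite mul0r.
  case: ifPn => [/agree_offP ut|_]; last by rewrite mulr0.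
  case/eqP: neu; apply: cvalP => v vZ; rewrite cval_patch vZ.
  by case: ifPn => [/dXY/ut//|/su].
rewrite !entry_embed agree_off_patch.
have -> : restr X u0 = restr X t.
  by apply: cvalP => v vX; rewrite !cval_restr vX cval_patch vX (fsubsetP XZ).
have -> : restr Y u0 = restr Y s.
  apply: cvalP => v vY; rewrite !cval_restr vY cval_patch.
  rewrite [v \in X]negbTE; first by case: ifPn => // /cval_out.
  by apply/negP => /dXY; rewrite vY.
have -> : agree_off Y u0 t = agree_off (X `|` Y) s t.
  apply/agree_offP/agree_offP => st v.
    rewrite in_fsetU negb_or => /andP[vX vY]; have := st v vY.
    by rewrite cval_patch (negPf vX); case: ifPn => // vZ; rewrite !(cval_out _ vZ).
  move=> vY; rewrite cval_patch; have [vZ|vZ] := boolP (v \in Z); last by rewrite cval_out.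
  by case: ifPn => // vX; apply: st; rewrite in_fsetU negb_or vX.
by case: ifP; rewrite ?mulr0.
Qed.

Lemma embed_comm X Y Z (a : op X) (b : op Y) : X `<=` Z -> Y `<=` Z -> [disjoint X & Y] ->
  GRing.comm (embed Z a) (embed Z b).
Proof.
move=> XZ YZ dXY; apply: entryP => s t.
rewrite !entry_embed_disjoint // 1?fdisjoint_sym // fsetUC.
by case: ifP => // _; rewrite mulrC.
Qed.

Lemma card_conf_neq0 X : #|conf d X|%:R != 0 :> R[i].
Proof. by rewrite pnatr_eq0 -lt0n; apply/card_gt0P; exists [ffun=> ord0]. Qed.

Lemma ntr_embed X Z (a : op X) : X `<=` Z -> ntr (embed Z a) = ntr a.
Proof.
move=> XZ; rewrite /ntr !mxtraceE.
under eq_bigr do rewrite entry_embed agree_off_refl.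
apply/eqP; rewrite eqr_div ?card_conf_neq0 // !mulr_natr; apply/eqP.
exact: (sum_restr (fun w => entry a w w)).
Qed.

Lemma ntrC X (a b : op X) : ntr (a * b) = ntr (b * a).
Proof. by rewrite /ntr [a * b]/(a *m b) mxtrace_mulC. Qed.

(** The partial trace as an average over configurations of any larger set
    [Z]: this form needs no decomposition of the sum over pairs, and its right-hand
    side is what resampling the coordinates in [S `\` X] produces. *)
Lemma ptr_average X S Z (g : op S) (s t : conf d X) : X `<=` S -> S `<=` Z ->
  entry (ptr X g) s t *+ #|conf d Z| =
  \sum_(r : conf d Z) entry g (patch X (restr S r) (cval s)) (patch X (restr S r) (cval t)).
Proof.
move=> XS SZ; rewrite entry_op_of.
have -> : \sum_(p : conf d S * conf d S | [&& restr X p.1 == s, restr X p.2 == t &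
    agree_off X p.1 p.2]) entry g p.1 p.2 =
   \sum_(p | restr X p == s) entry g p (patch X p (cval t)).
  rewrite (eq_bigl (fun p : conf d S * conf d S => (restr X p.1 == s) &&
     ((restr X p.2 == t) && agree_off X p.1 p.2))) //.
  rewrite -(pair_big_dep (fun p1 => restr X p1 == s)
      (fun p1 p2 => (restr X p2 == t) && agree_off X p1 p2) (fun p1 p2 => entry g p1 p2)) /=.
  apply: eq_bigr => p _; apply: big_pred1 => q /=.
  apply/andP/eqP => [[/eqP<- pq]|->]; first by rewrite patch_restr.
  by rewrite restr_patch // eqxx agree_off_patch.
have E := sum_patch s (fun p => entry g p (patch X p (cval t))) XS.
have E2 := sum_restr (fun p => entry g (patch X p (cval s)) (patch X p (cval t))) SZ.
have E3 (p : conf d S) : patch X (patch X p (cval s)) (cval t) = patch X p (cval t).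
  apply: cvalP => v vS; rewrite !cval_patch vS; by case: (v \in X).
rewrite (eq_bigr _ (fun p _ => congr1 (entry g _) (E3 p))) in E.
rewrite -mulr_natr; apply: (mulIf (card_conf_neq0 S)); rewrite [RHS]mulr_natr E2 E.
rewrite -[_ *+ #|_| *+ _]mulr_natr -[_ *+ #|_|]mulr_natr.
by field; rewrite card_conf_neq0.
Qed.

(** The defining property of the conditional expectation. The product
    [c * g] involves only entries at pairs agreeing on [S `\` X], and [c] does not
    see these coordinates since [Y] meets [S] inside [X]; averaging over them
    therefore affects only [g], and turns it into its partial trace. *)
Lemma ntr_mul_ptr X Y S Z (c : op Y) (g : op S) :
  X `<=` S -> S `<=` Z -> Y `&` S `<=` X ->
  ntr (embed Z c * embed Z g) = ntr (embed Z c * embed Z (ptr X g)).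
Proof.
move=> XS SZ /fsubsetP YSX; rewrite /ntr; congr (_ / _); rewrite !mxtraceE.
pose D := S `\` X.
have DY v : v \in D -> v \notin Y.
  rewrite in_fsetD => /andP[vX vS]; apply: contra vX => vY.
  by apply: YSX; rewrite in_fsetI vY.
have sumE T (e : op T) : \sum_s entry (embed Z c * embed Z e) s s =
  \sum_(s : conf d Z) \sum_(t | agree_off (Z `\` D) s t)
    entry (embed Z c) s t * entry (embed Z e) t s.
  apply: eq_bigr => s _; rewrite entryM [RHS]big_mkcond; apply: eq_bigr => t _.
  case: ifPn => // nst; rewrite entry_embed ifF ?mul0r //.
  apply: contraNF nst => /agree_offP st; apply/agree_offP => v.
  rewrite in_fsetD negb_and negbK => /orP[/DY/st//|vZ]; by rewrite !cval_out.
rewrite !sumE; apply: (mulIf (card_conf_neq0 Z)).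
rewrite !mulr_natr sum_resample -sumrMnl; apply: eq_bigr => s _.
rewrite -sumrMnl; apply: eq_bigr => t /agree_offP stD.
have ED v : v \in Z -> v \in D -> cval s v = cval t v.
  by move=> vZ vD; apply: stD; rewrite in_fsetD vD.
have RY (u : conf d Z) r : restr Y (patch D u r) = restr Y u.
  apply: cvalP => v vY; rewrite !cval_restr vY cval_patch.
  have /negPf-> : v \notin D by apply/negP => /DY; rewrite vY.
  by case: ifPn => // /cval_out.
have AO T r : agree_off T (patch D s r) (patch D t r) = agree_off T s t.
  apply/agree_offP/agree_offP => st v vT.
    have [vZ|vZ] := boolP (v \in Z); last by rewrite !(cval_out _ vZ).
    have [/ED->//|vD] := boolP (v \in D).
    by have := st v vT; rewrite !cval_patch vZ (negPf vD).
  by rewrite !cval_patch (st v vT).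
under eq_bigr do rewrite entry_embed AO !RY -entry_embed.
rewrite -mulr_sumr -mulrnAr; congr (_ * _).
under eq_bigr do rewrite entry_embed agree_offC AO.
rewrite entry_embed.
have <- : agree_off S s t = agree_off X t s.
  rewrite agree_offC; apply/agree_offP/agree_offP => ts v vX.
    have [vS|/ts//] := boolP (v \in S).
    have vZ := fsubsetP SZ _ vS.
    by rewrite (ED _ vZ) // in_fsetD vX.
  by apply: ts; apply: contra vX => /(fsubsetP XS).
case: ifPn => st; last by rewrite mul0rn big1.
rewrite ptr_average //; apply: eq_bigr => r _.
have E (u : conf d Z) : restr S (patch D u (cval r)) =
    patch X (restr S r) (cval (restr X u)).
  apply: cvalP => v vS; rewrite !(cval_restr, cval_patch) vS (fsubsetP SZ _ vS).
  by rewrite in_fsetD vS andbT; case: (v \in X).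
by rewrite !E.
Qed.

End LocalOperators.

(** * Adjoints and the spectral theorem *)

Section Adjoint.
Local Open Scope sesquilinear_scope.
Local Open Scope ring_scope.
Variables (R : realType) (d k : nat).
Implicit Types X Y Z : {fset vertex k}.
Local Notation op := (op R d).
Local Notation C := R[i].

Lemma adjK X : involutive (@adj R d k X).
Proof. by move=> a; rewrite /adj trmxCK. Qed.

Lemma adjM X (a b : op X) : adj (a * b) = adj b * adj a.
Proof. by rewrite /adj [a * b]/(a *m b) trmx_mul map_mxM. Qed.

Lemma adj1 X : adj (1 : op X) = 1.
Proof. by rewrite /adj [1]/(1%:M) trmx1 map_mx1. Qed.

Lemma adjD X (a b : op X) : adj (a + b) = adj a + adj b.
Proof. by rewrite /adj linearD map_mxD. Qed.

Lemma adjZ X (c : C) (a : op X) : adj (c *: a) = c^* *: adj a.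
Proof. by rewrite /adj linearZ map_mxZ. Qed.

Lemma adj_prod_ord X n (F : 'I_n -> op X) :
  adj (\prod_(i < n) F i) = \prod_(i < n) adj (F (rev_ord i)).
Proof.
elim: n F => [|n IHn] F; first by rewrite !big_ord0 adj1.
rewrite big_ord_recr big_ord_recl adjM IHn; congr (adj (F _) * _).
  by apply: val_inj; rewrite /= subn1.
apply: eq_bigr => i _; congr (adj (F _)); apply: val_inj => /=.
by rewrite /bump /= add1n subSS.
Qed.

Lemma ntr_mul_adj_ge0 X (a : op X) : 0 <= ntr (a * adj a).
Proof.
rewrite /ntr mulr_ge0 ?invr_ge0 ?ler0n // mxtraceE sumr_ge0 // => s _.
rewrite entryM sumr_ge0 // => u _; rewrite entry_adj.
exact: mul_conjC_ge0.
Qed.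

(** Polarization: for [h := a - adj a] the form [u h u^*] vanishes
    identically; testing it on [e_i + c e_j] with [c = 1] and [c = 'i] gives
    [h i j = - h j i] and [h i j = h j i]. *)
Lemma positive_adj X (a : op X) : positive_op a -> adj a = a.
Proof.
move=> a_ge0; pose h := a - adj a.
have h0 (u : 'rV[C]_#|conf d X|) : (u *m h *m u ^t*) 0 0 = 0.
  rewrite mulmxBr mulmxBl mxE [X in _ + X]mxE.
  have := a_ge0 u; rewrite dotmxE => /geC0_conj {1}<-.
  apply/eqP; rewrite subr_eq0; apply/eqP.
  transitivity ((u *m a *m u ^t*) ^t* 0 0); first by rewrite !mxE.
  by rewrite !trmx_mul !map_mxM trmxCK mulmxA.
suff hE i j : h i j = 0.
  by apply/esym/eqP; rewrite -subr_eq0; apply/eqP/matrixP => i j; rewrite hE mxE.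
clearbody h; have pol c : c^* * h i j + c * h j i = 0.
  pose e_ l : 'rV[C]_#|conf d X| := delta_mx 0 l.
  have e l m : (e_ l *m h *m (e_ m) ^t*) 0 0 = h l m :> C.
    rewrite /e_ -rowE trmx_delta map_delta_mx -colE.
    by rewrite !mxE.
  have T : (e_ i + c *: e_ j) ^t* = (e_ i) ^t* + c^* *: (e_ j) ^t*.
    by apply/matrixP => l m; rewrite !mxE rmorphD rmorphM.
  have := h0 (e_ i + c *: e_ j).
  rewrite T !(mulmxDl, mulmxDr).
  have S (M N : 'M[C]_1) : (M + N) 0 0 = M 0 0 + N 0 0 by rewrite mxE.
  have Z b (M : 'M[C]_1) : (b *: M) 0 0 = b * M 0 0 by rewrite mxE.
  rewrite -!(scalemxAl, scalemxAr) !(S, Z) !e.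
  have h_diag l : h l l = 0 by rewrite -e.
  by rewrite !h_diag !mulr0 addr0 add0r addrC.
have p1 := pol 1; have pi := pol 'i; rewrite conjC1 !mul1r in p1.
rewrite conjCi mulNr -mulrN -mulrDr in pi.
move/eqP: pi; rewrite mulf_eq0 (negPf (neq0Ci _)) /= addrC subr_eq0 => /eqP E.
move: p1; rewrite E -mulr2n => /eqP; rewrite mulrn_eq0 /= => /eqP //.
Qed.

Lemma spectral_adj X (a : op X) : adj a = a ->
  [/\ spectralmx a *m adj (spectralmx a : op X) = 1%:M,
      adj (spectralmx a : op X) *m spectralmx a = 1%:M,
      invmx (spectralmx a) = adj (spectralmx a : op X) &
      a = adj (spectralmx a : op X) *m diag_mx (spectral_diag a) *m spectralmx a].
Proof.
move=> aa; have U := spectral_unitarymx a.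
have PP : spectralmx a *m adj (spectralmx a : op X) = 1%:M by apply/unitarymxP.
have IP : invmx (spectralmx a) = adj (spectralmx a : op X) by apply: invmx_unitary.
split => //; first exact: mulmx1C.
rewrite -IP; apply/orthomx_spectralP/normalmxP.
by rewrite -/(adj a) aa.
Qed.

(** The spectral theorem in the form used to bound states: [f a] is then an
    average of the eigenvalues [l i] with the weights [f (p i)]. *)
Lemma spectral_decomposition X (a : op X) : adj a = a ->
  exists (l : 'I_#|conf d X| -> R) (p : 'I_#|conf d X| -> op X),
  [/\ a = \sum_i (l i)%:C *: p i, \sum_i p i = 1,
      forall i, p i <> 0, forall i, adj (p i) * p i = p i &
      forall i, a * p i = (l i)%:C *: p i].
Proof.
move=> aa; have [PP PP' _ aE] := spectral_adj aa.
set P := spectralmx a in PP PP' aE; set D := spectral_diag a in aE.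
pose p i : op X := adj (P : op X) *m delta_mx i i *m P.
have Dreal i : D 0 i = (complex.Re (D 0 i))%:C.
  apply/esym/RRe_real/CrealP.
  have DE : diag_mx D = P *m a *m adj (P : op X).
    by rewrite [in RHS]aE !mulmxA PP mul1mx -mulmxA PP mulmx1.
  have : adj (diag_mx D : op X) = diag_mx D.
    by rewrite DE -[X in adj X]/((P : op X) * a * adj (P : op X)) !adjM adjK aa mulrA.
  by move=> /matrixP/(_ i i); rewrite !mxE eqxx !mulr1n.
exists (fun i => complex.Re (D 0 i)), p; split.
- rewrite [LHS]aE diag_mx_sum_delta linear_sum /= mulmx_suml.
  by apply: eq_bigr => i _; rewrite -Dreal -scalemxAr -scalemxAl.
- rewrite /p -mulmx_suml -mulmx_sumr.
  have -> : \sum_i delta_mx i i = 1%:M :> 'M[C]_#|conf d X|.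
    by rewrite -diag_const_mx diag_mx_sum_delta; apply: eq_bigr => i _; rewrite mxE scale1r.
  by rewrite mulmx1.
- move=> i /(congr1 (fun m => (P *m m *m adj (P : op X)) i i)).
  rewrite /p !mulmxA PP mul1mx -mulmxA PP mulmx1 mulmx0 mul0mx !mxE !eqxx.
  by apply/eqP; rewrite oner_eq0.
- move=> i.
  have -> : adj (p i) = p i.
    rewrite /p -[X in adj X]/(adj (P : op X) * delta_mx i i * P) !adjM adjK mulrA.
    congr (_ * _ * _); by rewrite /adj trmx_delta map_delta_mx.
  rewrite /p -[LHS]/(_ *m _) !mulmxA -[_ *m P *m _]mulmxA PP mulmx1.
  by rewrite -[_ *m delta_mx i i *m delta_mx i i]mulmxA mul_delta_mx.
- move=> i; rewrite [in LHS]aE -[LHS]/(_ *m _) /p !mulmxA -[_ *m P *m _]mulmxA PP mulmx1.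
  rewrite -[_ *m _ *m delta_mx i i]mulmxA -Dreal.
  have -> : diag_mx D *m delta_mx i i = D 0 i *: delta_mx i i.
    apply/matrixP => r s; rewrite mul_diag_mx !mxE.
    by have [->|] := eqVneq r i; rewrite //= !mulr0.
  by rewrite -scalemxAr -scalemxAl.
Qed.

Lemma sqrt_op_positive X (a : op X) : positive_op a ->
  adj (sqrt_op a) = sqrt_op a /\ sqrt_op a * sqrt_op a = a.
Proof.
move=> a_ge0; have [PP PP' IP aE] := spectral_adj (positive_adj a_ge0).
rewrite /sqrt_op IP.
set P := spectralmx a in PP PP' IP aE *; set D := spectral_diag a in aE *.
have D_ge0 i : 0 <= D 0 i.
  have := a_ge0 (row i P); rewrite dotmxE.
  have DE : diag_mx D = P *m a *m adj (P : op X).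
    by rewrite [in RHS]aE !mulmxA PP mul1mx -mulmxA PP mulmx1.
  have -> : (row i P *m a *m (row i P) ^t*) 0 0 = (P *m a *m adj (P : op X)) i i.
    by rewrite -row_mul !mxE; apply: eq_bigr => j _; rewrite !mxE.
  by rewrite -DE mxE eqxx mulr1n.
split.
  have SD : adj (diag_mx (map_mx sqrtC D) : op X) = diag_mx (map_mx sqrtC D).
    apply/matrixP => i j; rewrite !mxE.
    have [->|] := eqVneq i j; last by rewrite !mulr0n rmorph0.
    by rewrite !mulr1n geC0_conj // sqrtC_ge0.
  rewrite -[X in adj X]/(adj (P : op X) * diag_mx (map_mx sqrtC D) * P) !adjM adjK mulrA.
  by rewrite SD.
rewrite [RHS]aE -[LHS]/(_ *m _) !mulmxA -[_ *m P *m _]mulmxA PP mulmx1.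
rewrite -[_ *m diag_mx _ *m diag_mx _]mulmxA mulmx_diag; congr (_ *m diag_mx _ *m _).
by apply/rowP => i; rewrite !mxE -expr2 sqrtCK.
Qed.

End Adjoint.

(** * Supports, and the geometry of the tree *)

(** Products over a layer of the tree may be reordered although the ambient
    algebra is not commutative, since their factors commute pairwise. *)
Lemma perm_prod_comm (A : pzSemiRingType) (I : eqType) (s t : seq I) (F : I -> A) :
  {in s &, forall x y, GRing.comm (F x) (F y)} -> perm_eq s t ->
  \prod_(x <- s) F x = \prod_(x <- t) F x.
Proof.
elim: s t => [|x s IHs] t comF st; first by move: st; rewrite perm_sym => /perm_nilP->.
have xt : x \in t by rewrite -(perm_mem st) mem_head.
case/splitPr: xt st => t1 t2 st.
rewrite big_cons big_cat big_cons /= mulrA.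
have st' : perm_eq s (t1 ++ t2).
  by rewrite -(perm_cons x) (perm_trans st) // perm_sym -cat1s perm_catCA.
have -> : \prod_(i <- t1) F i * F x = F x * \prod_(i <- t1) F i.
  rewrite big_seq; apply/esym/commr_prod => y yt1; apply: comF.
    exact: mem_head.
  by rewrite inE (perm_mem st') mem_cat yt1 orbT.
rewrite -mulrA -big_cat /= (IHs _ _ st') // => y z ys zs.
by apply: comF; rewrite inE ?ys ?zs orbT.
Qed.

Section Locality.
Variables (R : realType) (d k : nat).
Implicit Types X Y Z : {fset vertex k}.
Local Notation op := (op R d).

(** Membership in the subalgebra of [B_Z] attached to [X]. *)
Definition supported Z X (a : op Z) : Prop :=
  X `<=` Z /\ exists b : op X, a = embed Z b.

Lemma supported_embed X Z (a : op X) : X `<=` Z -> supported X (embed Z a).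
Proof. by move=> XZ; split=> //; exists a. Qed.

Lemma supportedS X Y Z (a : op Z) : X `<=` Y -> Y `<=` Z ->
  supported X a -> supported Y a.
Proof.
by move=> XY YZ [_ [b ->]]; split=> //; exists (embed Y b); rewrite embed_embed.
Qed.

Lemma supported1 X Z : X `<=` Z -> supported X (1 : op Z).
Proof. by move=> XZ; split=> //; exists 1; rewrite embed1. Qed.

Lemma supportedM X Z (a b : op Z) :
  supported X a -> supported X b -> supported X (a * b).
Proof.
by move=> [XZ [a' ->]] [_ [b' ->]]; split=> //; exists (a' * b'); rewrite embedM.
Qed.

Lemma supported_adj X Z (a : op Z) : supported X a -> supported X (adj a).
Proof. by move=> [XZ [b ->]]; split=> //; exists (adj b); rewrite embed_adj. Qed.

Lemma supported_prod X Z (I : Type) (s : seq I) (P : pred I) (F : I -> op Z) :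
  X `<=` Z -> (forall i, P i -> supported X (F i)) -> supported X (\prod_(i <- s | P i) F i).
Proof.
move=> XZ XF; elim/big_rec: _ => [|i a Pi]; first exact: supported1.
by apply: supportedM; exact: XF.
Qed.

Lemma supported_comm X Y Z (a b : op Z) : [disjoint X & Y] ->
  supported X a -> supported Y b -> GRing.comm a b.
Proof. by move=> dXY [XZ [a' ->]] [YZ [b' ->]]; exact: embed_comm. Qed.

Lemma embed_prod X Z (I : Type) (s : seq I) (F : I -> op X) : X `<=` Z ->
  embed Z (\prod_(i <- s) F i) = \prod_(i <- s) embed Z (F i).
Proof. by move=> XZ; apply: big_morph => [a b|]; rewrite ?embedM ?embed1. Qed.

(** Conjugating a product by a product factorizes when the supports attached to
    different indices are disjoint. It is used for a layer of the chain and, with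
    [e = 1], for the square roots on the boundary. *)
Lemma prod_conj Z (I : eqType) (s : seq I) (S : I -> {fset vertex k}) (q e : I -> op Z) :
  uniq s -> {in s &, forall x y, x != y -> [disjoint S x & S y]} ->
  {in s, forall x, supported (S x) (q x)} -> {in s, forall x, supported (S x) (e x)} ->
  (\prod_(x <- s) q x) * (\prod_(x <- s) e x) * adj (\prod_(x <- s) q x) =
  \prod_(x <- s) (q x * e x * adj (q x)).
Proof.
elim: s => [|x s IHs] /=; first by rewrite !big_nil adj1 !mulr1.
move=> /andP[xs us] dS Sq Se; rewrite !big_cons adjM -IHs //; first last.
- by move=> y ys; apply: Se; rewrite inE ys orbT.
- by move=> y ys; apply: Sq; rewrite inE ys orbT.
- by move=> y z ys zs; apply: dS; rewrite inE ?ys ?zs orbT.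
have far (a b : op Z) y : y \in s -> supported (S x) a -> supported (S y) b -> GRing.comm a b.
  move=> ys; apply: supported_comm; apply: dS; rewrite ?mem_head ?inE ?ys ?orbT //.
  by apply: contraNneq xs => ->.
have farP (a : op Z) (F : I -> op Z) : supported (S x) a ->
    {in s, forall y, supported (S y) (F y)} -> GRing.comm a (\prod_(y <- s) F y).
  move=> Sa SF; rewrite big_seq; apply: commr_prod => y ys.
  by apply: (far _ _ y) => //; apply: SF.
have Sq' y : y \in s -> supported (S y) (q y) by move=> ys; apply: Sq; rewrite inE ys orbT.
have Se' y : y \in s -> supported (S y) (e y) by move=> ys; apply: Se; rewrite inE ys orbT.
have Sqx : supported (S x) (q x) by apply: Sq; exact: mem_head.
have Sex : supported (S x) (e x) by apply: Se; exact: mem_head.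
set Q := \prod_(y <- s) q y; set E := \prod_(y <- s) e y.
have eQ : e x * Q = Q * e x by exact: farP.
have aQ : GRing.comm (adj (q x)) (Q * E * adj Q).
  apply: commrM; first by apply: commrM; apply: farP => //; exact: supported_adj.
  by rewrite /GRing.comm -!adjM (farP _ q).
rewrite -!mulrA; congr (_ * _); rewrite !mulrA -eQ -!mulrA; congr (_ * _).
by rewrite /GRing.comm -!mulrA in aQ; rewrite aQ.
Qed.

End Locality.

Section Tree.
Variable k : nat.

Lemma mem_W n (x : vertex k) : (x \in W k n) = (size x == n).
Proof.
apply/mapP/eqP => [[w _ ->]|<-]; first exact: size_tuple.
by exists (in_tuple x); rewrite ?mem_enum.
Qed.

Lemma W_uniq n : uniq (W k n).
Proof. by rewrite map_inj_uniq ?enum_uniq //; exact: val_inj. Qed.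

Lemma mem_Lambda n (x : vertex k) : (x \in Lambda k n) = (size x <= n)%N.
Proof.
rewrite /Lambda in_fset; apply/flatten_mapP/idP => [[m]|xn].
  by rewrite mem_iota mem_W => /andP[_ mn] /eqP ->.
by exists (size x); rewrite ?mem_iota ?mem_W.
Qed.

Lemma mem_succ_nbhd (x v : vertex k) :
  (v \in succ_nbhd x) = (v == x) || [exists i, v == child x i].
Proof.
rewrite /succ_nbhd in_fset1U in_fset /=; congr (_ || _).
apply/mapP/existsP => [[i _ ->]|[i /eqP->]]; first by exists i.
by exists i; rewrite ?mem_enum.
Qed.

Lemma succ_nbhd_disjoint (x y : vertex k) : size x = size y -> x != y ->
  [disjoint succ_nbhd x & succ_nbhd y].
Proof.
move=> sxy nxy; apply/fdisjointP => v; rewrite !mem_succ_nbhd negb_or.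
move=> /orP[/eqP->|/existsP[i /eqP->]].
  rewrite nxy; apply/existsPn => i; apply/eqP => /(congr1 size)/eqP.
  by rewrite sxy size_rcons eqn_leq ltnn andbF.
apply/andP; split.
  apply/eqP => /(congr1 size)/eqP.
  by rewrite -sxy size_rcons eqn_leq ltnn.
by apply/existsPn => j; rewrite eqseq_rcons (negPf nxy).
Qed.

Lemma Lambda_mono m n : (m <= n)%N -> Lambda k m `<=` Lambda k n.
Proof. by move=> mn; apply/fsubsetP => v; rewrite !mem_Lambda => /leq_trans; exact. Qed.

Lemma fset1_Lambda n (x : vertex k) : size x = n -> [fset x] `<=` Lambda k n.
Proof. by move=> xn; rewrite fsub1set mem_Lambda xn. Qed.

Lemma succ_nbhd_Lambda n (x : vertex k) : size x = n -> succ_nbhd x `<=` Lambda k n.+1.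
Proof.
move=> xn; apply/fsubsetP => v; rewrite mem_succ_nbhd mem_Lambda -xn.
by move=> /orP[/eqP->|/existsP[i /eqP->]]; rewrite ?size_rcons ?leqnSn.
Qed.

Lemma edge_succ_nbhd (x : vertex k) i : edge x i `<=` succ_nbhd x.
Proof.
apply/fsubsetP => v; rewrite mem_succ_nbhd !inE => /orP[->//|vi].
by apply/orP; right; apply/existsP; exists i.
Qed.

Lemma child_succ_nbhd (x : vertex k) i : [fset child x i] `<=` succ_nbhd x.
Proof. by rewrite fsub1set mem_succ_nbhd; apply/orP; right; apply/existsP; exists i. Qed.

Lemma self_succ_nbhd (x : vertex k) : [fset x] `<=` succ_nbhd x.
Proof. by rewrite fsub1set mem_succ_nbhd eqxx. Qed.

(** Regrouping the next level by parents turns the boundary product of the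
    [h_y] into the product over the level of the factors in the consistency
    condition. *)
Lemma perm_W_succ n : perm_eq (W k n.+1) [seq child x i | x <- W k n, i <- enum 'I_k].
Proof.
apply: uniq_perm; first exact: W_uniq.
  apply: allpairs_uniq; rewrite ?W_uniq ?enum_uniq // => -[x i] [y j] _ _ /=.
  by move=> /rcons_inj[-> ->].
move=> v; rewrite mem_W; apply/eqP/allpairsP => [|[[x i] /= [xW _ ->]]].
  case/lastP: v => // v i; rewrite size_rcons => -[vn].
  by exists (v, i); rewrite mem_W vn eqxx mem_enum.
by move: xW; rewrite mem_W size_rcons => /eqP->.
Qed.

Lemma W0 : W k 0 = [:: x0 k].
Proof.
apply: perm_small_eq => //; apply: uniq_perm; rewrite ?W_uniq // => v.
by rewrite mem_W inE size_eq0.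
Qed.

End Tree.

(** * The functionals of the chain *)

Lemma mul_comm_layer (A : pzSemiRingType) (r p q a b q' p' r' : A) : GRing.comm a q ->
  r * (p * q) * a * b * (q' * p') * r' = (r * p * a) * (q * b * q') * (p' * r').
Proof. by move=> aq; rewrite -!mulrA [a * (q * _)]mulrA aq !mulrA. Qed.

Lemma mul_comm_boundary (A : pzSemiRingType) (r p a b b' p' r' : A) : GRing.comm a b ->
  r * p * b * (a * (b' * (p' * r'))) = r * p * a * (b * b') * p' * r'.
Proof. by move=> ab; rewrite !mulrA -[_ * b * a]mulrA -ab !mulrA. Qed.

Section Chain.
Variables (R : realType) (d k : nat).
Local Notation op := (op R d).
Local Notation Lam := (Lambda k).
Implicit Types Z : {fset vertex k}.
Variable K : forall (x : vertex k) (i : 'I_k), op (edge x i).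
Variable w0 : op [fset x0 k].
Variable h : forall x : vertex k, op [fset x].
Hypothesis w0_ge0 : positive_op w0.
Hypothesis h_ge0 : forall x : vertex k, positive_op (h x).
Hypothesis Kh : forall x : vertex k, consistent K h x.

(** The local pieces of the chain, formed inside an arbitrary finite region [Z]:
    all identities are proved in one region and transported by [embed]. *)
Definition edges_op Z x : op Z := \prod_(i < k) embed Z (K x i).

Definition children_op Z x : op Z := \prod_(i < k) embed Z (h (child x i)).

Definition vertex_block Z x : op Z :=
  edges_op Z x * children_op Z x * adj (edges_op Z x).

Definition layer_op Z n : op Z := \prod_(x <- W k n) edges_op Z x.

Definition boundary_op Z n : op Z := \prod_(x <- W k n) embed Z (h x).

Definition layers_op Z n : op Z := \prod_(m < n) layer_op Z m.

Lemma layers_opS Z n : layers_op Z n.+1 = layers_op Z n * layer_op Z n.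
Proof. by rewrite /layers_op big_ord_recr. Qed.

Lemma edges_op_supported Z x : succ_nbhd x `<=` Z ->
  supported (succ_nbhd x) (edges_op Z x).
Proof.
move=> xZ; apply: supported_prod => // i _.
apply: (supportedS (edge_succ_nbhd x i)) => //.
apply: supported_embed; exact: fsubset_trans (edge_succ_nbhd x i) xZ.
Qed.

Lemma children_op_supported Z x : succ_nbhd x `<=` Z ->
  supported (succ_nbhd x) (children_op Z x).
Proof.
move=> xZ; apply: supported_prod => // i _.
apply: (supportedS (child_succ_nbhd x i)) => //.
apply: supported_embed; exact: fsubset_trans (child_succ_nbhd x i) xZ.
Qed.

Lemma embed_edges_op X Z x : succ_nbhd x `<=` X -> X `<=` Z ->
  embed Z (edges_op X x) = edges_op Z x.
Proof.
move=> xX XZ; rewrite embed_prod //; apply: eq_bigr => i _.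
by rewrite embed_embed // (fsubset_trans (edge_succ_nbhd x i)).
Qed.

Lemma embed_vertex_block X Z x : succ_nbhd x `<=` X -> X `<=` Z ->
  embed Z (vertex_block X x) = vertex_block Z x.
Proof.
move=> xX XZ; rewrite /vertex_block !embedM // embed_adj embed_edges_op //.
congr (_ * _ * _); rewrite embed_prod //; apply: eq_bigr => i _.
by rewrite embed_embed // (fsubset_trans (child_succ_nbhd x i)).
Qed.

Lemma ptr_vertex_block x : ptr [fset x] (vertex_block (succ_nbhd x) x) = h x.
Proof.
rewrite -[RHS](Kh x) /vertex_block /edges_op adj_prod_ord.
by [].
Qed.

(** The neighbourhoods of distinct vertices of one level are disjoint, so the
    conjugate of the boundary by the layer splits into one factor per vertex. *)
Lemma layer_conj Z n : Lam n.+1 `<=` Z ->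
  layer_op Z n * boundary_op Z n.+1 * adj (layer_op Z n) =
  \prod_(x <- W k n) vertex_block Z x.
Proof.
move=> nZ.
have SZ x : x \in W k n -> succ_nbhd x `<=` Z.
  by rewrite mem_W => /eqP xn; apply: fsubset_trans nZ; exact: succ_nbhd_Lambda.
have -> : boundary_op Z n.+1 = \prod_(x <- W k n) children_op Z x.
  rewrite /boundary_op (perm_prod_comm _ (perm_W_succ k n)).
    rewrite big_allpairs_dep; apply: eq_bigr => x _.
    by rewrite /children_op [index_enum _]unlock -enumT.
  move=> x y; rewrite !mem_W => /eqP xn /eqP yn.
  have [->//|xy] := eqVneq x y.
  have sub v : size v = n.+1 -> [fset v] `<=` Z.
    by move=> vn; apply: fsubset_trans nZ; exact: fset1_Lambda.
  by apply: embed_comm; rewrite ?sub // fdisjoint1X inE.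
apply: (prod_conj (S := @succ_nbhd k)); first exact: W_uniq.
- move=> x y; rewrite !mem_W => /eqP xn /eqP yn.
  by apply: succ_nbhd_disjoint; rewrite xn.
- by move=> x /SZ; exact: edges_op_supported.
- by move=> x /SZ; exact: children_op_supported.
Qed.

(** One vertex at a time: by cyclicity of the trace the block of [x] stands next
    to a product that avoids the children of [x], so [ntr_mul_ptr] replaces the block
    by its partial trace, which is [h x] by the consistency condition. *)
Lemma ntr_vertex_blocks Z n (s : seq (vertex k)) (u v : op Z) : Lam n.+1 `<=` Z ->
  uniq s -> {subset s <= W k n} -> supported (Lam n) u -> supported (Lam n) v ->
  ntr (u * (\prod_(x <- s) vertex_block Z x) * v) =
  ntr (u * (\prod_(x <- s) embed Z (h x)) * v).
Proof.
move=> nZ; elim: s u v => [|x s IHs] u v; first by rewrite !big_nil.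
rewrite cons_uniq => /andP[xs us] sW Lu Lv; rewrite !big_cons.
have size_n y : y \in x :: s -> size y = n by move/sW; rewrite mem_W => /eqP.
have SZ y : y \in x :: s -> succ_nbhd y `<=` Z.
  by move=> ys; apply: fsubset_trans nZ; apply: succ_nbhd_Lambda; exact: size_n.
have xZ := SZ x (mem_head _ _).
(* Everything except the block of [x] lives away from the children of [x]. *)
pose Y := Z `\` (succ_nbhd x `\ x).
have YZ : Y `<=` Z by exact: fsubsetDl.
have LY (a : op Z) : supported (Lam n) a -> supported Y a.
  apply: supportedS => //; apply/fsubsetP => w wn; rewrite /Y in_fsetD.
  rewrite (fsubsetP nZ) ?(fsubsetP (Lambda_mono k (leqnSn n)) _ wn) // andbT in_fsetD1 negb_and.
  rewrite mem_succ_nbhd; have [//|wx /=] := eqVneq w x.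
  apply/existsPn => i; apply/eqP => wE; move: wn.
  by rewrite wE mem_Lambda size_rcons (size_n x) ?mem_head // ltnn.
have blockY y : y \in s -> supported Y (vertex_block Z y).
  move=> ys; have yxs : y \in x :: s by rewrite inE ys orbT.
  have sub : succ_nbhd y `<=` Y.
    apply/fsubsetP => w wy; rewrite /Y in_fsetD (fsubsetP (SZ y yxs)) // andbT.
    rewrite in_fsetD1 negb_and orbC.
    suff /fdisjointP/(_ w wy) -> : [disjoint succ_nbhd y & succ_nbhd x] by [].
    apply: succ_nbhd_disjoint; first by rewrite !size_n ?mem_head.
    by apply: contraNneq xs => <-.
  apply: (supportedS sub) => //; apply: supportedM; last first.
    by apply: supported_adj; apply: edges_op_supported; apply: SZ.
  apply: supportedM; first by apply: edges_op_supported; apply: SZ.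
  by apply: children_op_supported; apply: SZ.
have [_ [c cE]] : supported Y ((\prod_(y <- s) vertex_block Z y) * v * u).
  apply: supportedM; last exact: LY.
  apply: supportedM; last exact: LY.
  by rewrite big_seq; apply: supported_prod.
transitivity (ntr ((\prod_(y <- s) vertex_block Z y) * v * u * vertex_block Z x)).
  by rewrite ntrC !mulrA ntrC !mulrA.
rewrite cE -(embed_vertex_block (fsubset_refl _) xZ).
rewrite (ntr_mul_ptr (X := [fset x])) //; last 2 first.
- exact: self_succ_nbhd.
- apply/fsubsetP => w; rewrite in_fsetI /Y in_fsetD in_fsetD1 inE.
  by case: (w == x) => //= /andP[/andP[/negPf->]].
rewrite ptr_vertex_block -cE.
have Lux : supported (Lam n) (u * embed Z (h x)).
  apply: supportedM => //.
  have sub : [fset x] `<=` Lam n by apply: fset1_Lambda; apply: size_n; exact: mem_head.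
  have LZ : Lam n `<=` Z := fsubset_trans (Lambda_mono k (leqnSn n)) nZ.
  by apply: (supportedS sub) => //; apply: supported_embed; exact: fsubset_trans sub LZ.
rewrite !mulrA -[RHS]IHs //; last by move=> y ys; apply: sW; rewrite inE ys orbT.
by rewrite -!mulrA ntrC !mulrA [RHS]ntrC !mulrA.
Qed.

Lemma ntr_layer Z n (u v : op Z) : Lam n.+1 `<=` Z ->
  supported (Lam n) u -> supported (Lam n) v ->
  ntr (u * (layer_op Z n * boundary_op Z n.+1 * adj (layer_op Z n)) * v) =
  ntr (u * boundary_op Z n * v).
Proof.
move=> nZ Lu Lv; rewrite (layer_conj nZ).
exact: (ntr_vertex_blocks nZ (W_uniq k n) (fun=> id) Lu Lv).
Qed.

Definition root_op Z : op Z := embed Z (sqrt_op w0).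

(** The functional in the order in which it is computed: cyclicity has moved
    the factors to the left of [a], and the two boundary square roots, which commute
    with [a], have been merged into [boundary_op]. *)
Definition chain_trace Z n (a : op Z) : R[i] :=
  ntr (root_op Z * layers_op Z n.+1 * a * boundary_op Z n.+1 *
       adj (layers_op Z n.+1) * root_op Z).

Lemma root_sub n : [fset x0 k] `<=` Lam n.
Proof. by rewrite fsub1set mem_Lambda. Qed.

Lemma boundary_sub n x : x \in W k n -> [fset x] `<=` Lam n.
Proof. by rewrite mem_W => /eqP; exact: fset1_Lambda. Qed.

Lemma phin_chain_trace n (a : op (Lam n)) :
  phin K w0 h a = chain_trace n (embed (Lam n.+1) a).
Proof.
set Z := Lam n.+1; rewrite /phin /Wop /Kprod -/Z.
rewrite -/(root_op Z) -/(layers_op Z n.+1).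
set H2 := \prod_(x <- W k n.+1) embed Z (sqrt_op (h x)).
set A := embed Z a.
have H2H2 : H2 * adj H2 = boundary_op Z n.+1.
  have := prod_conj (s := W k n.+1) (S := fun x => [fset x])
     (q := fun x => embed Z (sqrt_op (h x))) (e := fun=> 1).
  rewrite big1_eq mulr1 => ->; first last.
  - by move=> x xn; apply: supported1; exact: boundary_sub.
  - by move=> x xn; apply: supported_embed; exact: boundary_sub.
  - by move=> x y _ _ xy; rewrite fdisjoint1X inE.
  - exact: W_uniq.
  rewrite /boundary_op !big_seq; apply: eq_bigr => x xn.
  have [sa ss] := sqrt_op_positive (@h_ge0 x).
  by rewrite mulr1 -embed_adj sa -embedM ?ss //; exact: boundary_sub.
have H2A : GRing.comm A H2.
  rewrite /H2 big_seq; apply: commr_prod => x xn; apply: embed_comm.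
  - exact: Lambda_mono.
  - exact: boundary_sub.
  - by rewrite fdisjointX1 mem_Lambda; move: xn; rewrite mem_W => /eqP->; rewrite ltnn.
have r2 : adj (root_op Z) = root_op Z.
  by rewrite -embed_adj (sqrt_op_positive w0_ge0).1.
rewrite /chain_trace -H2H2 -mulrA ntrC -mulrA !adjM r2.
by congr ntr; exact: mul_comm_boundary.
Qed.

Lemma embed_layer_op X Z n : Lam n.+1 `<=` X -> X `<=` Z ->
  embed Z (layer_op X n) = layer_op Z n.
Proof.
move=> nX XZ; rewrite /layer_op embed_prod // !big_seq; apply: eq_bigr => x.
rewrite mem_W => /eqP xn; rewrite embed_edges_op //.
exact: fsubset_trans (succ_nbhd_Lambda xn) nX.
Qed.

Lemma embed_layers_op X Z n : Lam n `<=` X -> X `<=` Z ->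
  embed Z (layers_op X n) = layers_op Z n.
Proof.
move=> nX XZ; rewrite /layers_op embed_prod //; apply: eq_bigr => m _.
by apply: embed_layer_op => //; exact: fsubset_trans (Lambda_mono k (ltn_ord m)) nX.
Qed.

Lemma embed_boundary_op X Z n : Lam n `<=` X -> X `<=` Z ->
  embed Z (boundary_op X n) = boundary_op Z n.
Proof.
move=> nX XZ; rewrite /boundary_op embed_prod // !big_seq; apply: eq_bigr => x xn.
rewrite embed_embed //; exact: fsubset_trans (boundary_sub xn) nX.
Qed.

Lemma embed_root_op n X Z : Lam n `<=` X -> X `<=` Z ->
  embed Z (root_op X) = root_op Z.
Proof. by move=> nX XZ; rewrite embed_embed // (fsubset_trans (root_sub n)). Qed.

Lemma chain_trace_embed X Z n (a : op X) : Lam n.+1 `<=` X -> X `<=` Z ->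
  chain_trace n (embed Z a) = chain_trace n a.
Proof.
move=> nX XZ; rewrite /chain_trace -[RHS](ntr_embed _ XZ).
have E (r p b c : op X) : embed Z (r * p * b * c * adj p * r) =
    embed Z r * embed Z p * embed Z b * embed Z c * adj (embed Z p) * embed Z r.
  by do 5! rewrite (embedM _ _ XZ); rewrite embed_adj.
by rewrite E (embed_layers_op nX XZ) (embed_boundary_op nX XZ) (embed_root_op nX XZ).
Qed.

Lemma layers_op_supported Z n : Lam n `<=` Z -> supported (Lam n) (layers_op Z n).
Proof. by move=> nZ; split=> //; exists (layers_op (Lam n) n); rewrite embed_layers_op. Qed.

Lemma root_op_supported Z n : Lam n `<=` Z -> supported (Lam n) (root_op Z).
Proof.
by move=> nZ; split=> //; exists (root_op (Lam n)); rewrite (embed_root_op (fsubset_refl _)).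
Qed.

(** The last layer only involves vertices of levels [n.+1] and [n.+2]. *)
Lemma layer_op_comm Z n (a : op (Lam n)) : Lam n.+2 `<=` Z ->
  GRing.comm (embed Z a) (layer_op Z n.+1).
Proof.
move=> nZ; rewrite /layer_op big_seq; apply: commr_prod => x.
rewrite mem_W => /eqP xn.
have nZ' : Lam n `<=` Z by apply: fsubset_trans nZ; apply: Lambda_mono; rewrite leqW.
apply: (@supported_comm _ _ _ (Lam n) (succ_nbhd x)).
- apply/fdisjointP => v; rewrite mem_Lambda => vn.
  rewrite mem_succ_nbhd negb_or; apply/andP; split.
    by apply/eqP => vE; move: vn; rewrite vE xn ltnn.
  apply/existsPn => i; apply/eqP => vE.
  by move: vn; rewrite vE size_rcons xn ltnNge leqW.
- exact: supported_embed.
- by apply: edges_op_supported; apply: fsubset_trans nZ; exact: succ_nbhd_Lambda.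
Qed.

(** Since [a] commutes with the outermost layer, this layer conjugates the
    boundary only, and [ntr_layer] collapses it to the previous boundary. *)
Lemma phin_compatible n (a : op (Lam n)) :
  phin K w0 h (embed (Lam n.+1) a) = phin K w0 h a.
Proof.
have L01 := Lambda_mono k (leqnSn n); have L12 := Lambda_mono k (leqnSn n.+1).
have L02 := fsubset_trans L01 L12.
rewrite !phin_chain_trace -(chain_trace_embed _ (fsubset_refl _) L12).
rewrite (embed_embed a L01 L12).
set Z := Lam n.+2; rewrite /chain_trace (layers_opS Z n.+1) adjM.
have Su : supported (Lam n.+1) (root_op Z * layers_op Z n.+1 * embed Z a).
  apply: supportedM; last exact: (supportedS L01 L12 (supported_embed a L02)).
  by apply: supportedM; [exact: root_op_supported|exact: layers_op_supported].
have Sv : supported (Lam n.+1) (adj (layers_op Z n.+1) * root_op Z).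
  apply: supportedM; last exact: root_op_supported.
  by apply: supported_adj; exact: layers_op_supported.
have aQ := layer_op_comm a (fsubset_refl Z).
rewrite (mul_comm_layer _ _ _ _ _ _ aQ) (ntr_layer (fsubset_refl Z) Su Sv).
by congr ntr; rewrite [LHS]mulrA.
Qed.

Lemma phin_compatible_add m n (a : op (Lam m)) :
  phin K w0 h (embed (Lam (m + n)) a) = phin K w0 h a.
Proof.
elim: n => [|n IHn]; first by rewrite addn0 embed_id.
rewrite addnS -IHn -[RHS]phin_compatible embed_embed //; apply: Lambda_mono.
  exact: leq_addr.
exact: leqnSn.
Qed.

(** By compatibility it suffices to take [n = 0]; collapsing the single layer
    leaves the normalized trace of [w0 * h x0]. *)
Lemma phin1 n : ntr (w0 * h (x0 k)) = 1 -> phin K w0 h (1 : op (Lam n)) = 1.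
Proof.
move=> w0h.
have -> : phin K w0 h (1 : op (Lam n)) = phin K w0 h (1 : op (Lam 0)).
  have := phin_compatible_add n (1 : op (Lam 0)).
  by rewrite embed1; [move=> <- | exact: Lambda_mono].
rewrite phin_chain_trace embed1; last exact: Lambda_mono.
set Z := Lam 1; rewrite /chain_trace layers_opS adjM.
rewrite mul_comm_layer; last exact: commr_sym (commr1 _).
rewrite /layers_op big_ord0 adj1 !mulr1 mul1r.
rewrite ntr_layer //; last 2 first.
- by apply: root_op_supported; exact: Lambda_mono.
- by apply: root_op_supported; exact: Lambda_mono.
rewrite ntrC mulrA /root_op -embedM ?root_sub // (sqrt_op_positive w0_ge0).2.
by rewrite /boundary_op W0 big_seq1 -embedM ?root_sub // ntr_embed ?root_sub.
Qed.

Lemma phin_scalar n : scalar (@phin R d k K w0 h n).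
Proof.
move=> c a b; rewrite /phin /ntr embedD embedZ mulrDr.
rewrite -[X in X + _]/(_ *m _) -scalemxAr.
by rewrite linearD linearZ /= mulrDl mulrA.
Qed.

Lemma phin_ge0 n (a : op (Lam n)) : 0 <= phin K w0 h (adj a * a).
Proof.
rewrite /phin /Wop embedM; last exact: Lambda_mono.
rewrite embed_adj -mulrA ntrC.
move: (Kprod _ _ _ _) (embed _ a) => m b.
have := ntr_mul_adj_ge0 (m * adj b).
by rewrite (adjM m) adjK !mulrA.
Qed.

End Chain.

(** * States of C*-algebras *)

Section ComplexBounds.
Variable R : realType.
Local Notation C := R[i].

Lemma normci : `|('i%C : C)| = 1.
Proof. by rewrite normc_def /= expr0n expr1n add0r sqrtr1. Qed.

Lemma normc_ge_Im (z : C) : `|complex.Im z|%:C <= `|z|.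
Proof.
rewrite -normrN -ReiNIm; apply: le_trans (normc_ge_Re _) _.
by rewrite normrM normci mulr1.
Qed.

Lemma normc_real (r : R) : `|r%:C| = `|r|%:C :> C.
Proof. by rewrite normc_def /= expr0n addr0 sqrtr_sqr. Qed.

Lemma normc_le_ReIm (z : C) : `|z| <= (`|complex.Re z| + `|complex.Im z|)%:C.
Proof.
rewrite {1}[z]complexE; apply: le_trans (ler_normD _ _) _.
by rewrite normrM normci mul1r !normc_real rmorphD.
Qed.

Lemma normcP (z : C) : exists2 r : R, 0 <= r & `|z| = r%:C.
Proof. by rewrite normc_def; eexists; last reflexivity; exact: sqrtr_ge0. Qed.

(** The epsilon arguments below only produce bounds up to a constant factor;
    [le0_approx], [eq_approx] and [ge0_approx] absorb the constant. *)
Lemma le0_approx (r c : R) : (forall e : R, 0 < e -> r <= c * e) -> r <= 0.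
Proof.
move=> rc; apply/ler_addgt0Pr => e e_gt0; rewrite add0r.
have c1 : 0 < `|c| + 1 by rewrite ltr_wpDl.
have := rc (e / (`|c| + 1)) (divr_gt0 e_gt0 c1).
move=> /le_trans; apply; rewrite mulrCA ler_piMr ?(ltW e_gt0) //.
by rewrite ler_pdivrMr // mul1r (le_trans (ler_norm c)) // lerDl.
Qed.

Lemma eq_approx (z w : C) (c : R) :
  (forall e : R, 0 < e -> `|z - w| <= (c * e)%:C) -> z = w.
Proof.
have [r r_ge0 zwr] := normcP (z - w); rewrite zwr => zw.
have r0 : r = 0.
  by apply/le_anti; rewrite r_ge0 andbT (@le0_approx _ c) // => e /zw; rewrite lecR.
by apply/eqP; rewrite -subr_eq0 -normr_eq0 zwr r0.
Qed.

Lemma ge0_approx (z : C) (c : R) :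
  (forall e : R, 0 < e -> exists2 w, 0 <= w & `|z - w| <= (c * e)%:C) -> 0 <= z.
Proof.
move=> zw; rewrite lecE /=; apply/andP; split.
  suff : `|complex.Im z| <= 0 by rewrite normr_le0.
  apply: (@le0_approx _ c) => e /zw[w w0 zwe]; rewrite -lecR.
  apply: le_trans zwe; apply: le_trans (normc_ge_Im _).
  by rewrite raddfB /= (ger0_Im w0) subr0.
rewrite -oppr_le0; apply: (@le0_approx _ c) => e /zw[w w0 zwe].
have : complex.Re (w - z) <= c * e.
  rewrite -lecR; apply: le_trans zwe; rewrite distrC.
  by apply: le_trans (normc_ge_Re _); rewrite lecR ler_norm.
apply: le_trans; rewrite raddfB /= lerBrDr addNr.
by move: w0; rewrite lecE => /andP[].
Qed.

Section HermitianBound.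
Variables (V : lmodType C) (N : V -> R) (st : V -> V) (f : V -> C).
Hypothesis f_scalar : scalar f.
Hypothesis ND : forall a b, N (a + b) <= N a + N b.
Hypothesis NZ : forall (c : C) a, (N (c *: a))%:C = `|c| * (N a)%:C.
Hypothesis Nst : forall a, N (st a) = N a.
Hypothesis stK : involutive st.
Hypothesis stD : forall a b, st (a + b) = st a + st b.
Hypothesis stZ : forall (c : C) a, st (c *: a) = c^* *: st a.
Hypothesis f_bound : forall a, st a = a -> `|f a| <= (N a)%:C.

(** Write [2 a = (a + st a) + (a - st a)]; the first summand is hermitian and the
    second is so after multiplication by ['i]. The statement is about a normed
    space with an involution because it serves both the local matrix algebras,
    normed through their embedding, and the limit algebra. *)
Lemma hermitian_bound a : `|f a| <= (2 * N a)%:C.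
Proof.
have fD u v : f (u + v) = f u + f v by have := f_scalar 1 u v; rewrite scale1r mul1r.
have f0 : f 0 = 0 by apply: (addIr (f 0)); rewrite -fD !add0r.
have fZ c u : f (c *: u) = c * f u by have := f_scalar c u 0; rewrite !addr0 f0 addr0.
have N2 c u : `|c| = 1 -> N (c *: u) = N u.
  by move=> c1; apply: complexI; rewrite NZ c1 mul1r.
(* [c = 1] and [c = 'i] give the two hermitian combinations. *)
have le2 c : `|c| = 1 -> c^* = c \/ c^* = - c ->
    `|f (c *: (a + (c^* / c) *: st a))| <= (2 * N a)%:C.
  move=> c1 cc; apply: le_trans (f_bound _) _.
    rewrite stZ stD stZ stK.
    have c0 : c != 0 by rewrite -normr_eq0 c1 oner_eq0.
    case: cc => E; rewrite !E.
      by rewrite divff // rmorph1 !scale1r addrC.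
    rewrite mulNr divff // rmorphN rmorph1 !scaleN1r scalerBr !scaleNr opprK.
    by rewrite addrC scalerBr.
  rewrite lecR N2 // (le_trans (ND _ _)) // mulr2n mulrDl !mul1r lerD2l N2 ?Nst //.
  by case: cc => ->; rewrite ?mulNr ?normrN divff ?normr1 // -normr_eq0 c1 oner_eq0.
have b1 : `|f (a + st a)| <= (2 * N a)%:C.
  have := le2 1 (normr1 _); rewrite conjC1 divr1 !scale1r; apply; by left.
have b2 : `|f (a - st a)| <= (2 * N a)%:C.
  have [w w1 ww] : exists2 w : C, `|w| = 1 & w^* = - w.
    by exists 'i%C; [exact: normci | exact: conjCi].
  have w0 : w != 0 by rewrite -normr_eq0 w1 oner_eq0.
  have := le2 w w1; rewrite fZ normrM w1 mul1r ww mulNr divff // scaleN1r.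
  by apply; right.
have : `|2 * f a| <= 2 * (2 * N a)%:C.
  rewrite [X in `|X|](_ : _ = f (a + st a) + f (a - st a)); last first.
    by rewrite -fD addrACA subrr addr0 fD mulr2n mulrDl !mul1r.
  by rewrite (le_trans (ler_normD _ _)) // mulr2n mulrDl !mul1r lerD.
by rewrite normrM ger0_norm ?ler0n // ler_pM2l ?ltr0n.
Qed.

End HermitianBound.
End ComplexBounds.

Section CstarAlgebras.
Variables (R : realType) (B : cstarAlgebra R).
Local Notation C := R[i].
Implicit Types a b x y : B.

Lemma cnorm_unit (c : C) a : `|c| = 1 -> cnorm (c *: a) = cnorm a.
Proof. by move=> c1; apply: complexI; rewrite cnormZ c1 mul1r. Qed.

Lemma cnormZr (r : R) a : cnorm (r%:C *: a) = `|r| * cnorm a.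
Proof. by apply: complexI; rewrite cnormZ normc_real rmorphM. Qed.

Lemma cnorm0 : cnorm (0 : B) = 0.
Proof. by rewrite -[0 in LHS](scale0r (0 : B)) (cnormZr 0) normr0 mul0r. Qed.

Lemma cnormN a : cnorm (- a) = cnorm a.
Proof. by rewrite -scaleN1r cnorm_unit // normrN1. Qed.

Lemma cnorm_ge0 a : 0 <= cnorm a.
Proof.
by have := cnormD a (- a); rewrite subrr cnorm0 cnormN -mulr2n pmulrn_lge0.
Qed.

Lemma cnormB a b : cnorm (a - b) <= cnorm a + cnorm b.
Proof. by rewrite -(cnormN b) cnormD. Qed.

Lemma cnorm_distC a b : cnorm (a - b) = cnorm (b - a).
Proof. by rewrite -cnormN opprB. Qed.

Lemma cnorm_dist b a c : cnorm (a - c) <= cnorm (a - b) + cnorm (b - c).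
Proof. by apply: le_trans (cnormD _ _); rewrite addrA subrK. Qed.

Lemma star0 : star (0 : B) = 0.
Proof. by apply: (addIr (star 0)); rewrite -starD !add0r. Qed.

Lemma starN a : star (- a) = - star a.
Proof. by apply: (addIr (star a)); rewrite -starD !addNr star0. Qed.

Lemma star1 : star (1 : B) = 1.
Proof. by rewrite -[RHS]starK -[in RHS](mulr1 (star 1)) starM starK mulr1. Qed.

Lemma cnorm_star a : cnorm (star a) = cnorm a.
Proof.
have le b : cnorm b <= cnorm (star b).
  have := cnorm_ge0 b; rewrite le_eqVlt => /orP[/eqP<-|b_gt0]; first exact: cnorm_ge0.
  by rewrite -(ler_pM2r b_gt0) -expr2 -cstar_identity cnormM.
by apply/le_anti; rewrite le andbT -{2}[a]starK le.
Qed.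

Lemma cnorm_eq_approx a b (c : R) :
  (forall e : R, 0 < e -> cnorm (a - b) <= c * e) -> a = b.
Proof.
move=> ab; apply/eqP; rewrite -subr_eq0; apply/eqP/cnorm0_eq0/le_anti.
by rewrite cnorm_ge0 andbT (le0_approx ab).
Qed.

(** The square root of [1 - x] without power series: [1 - y] is a square root
    when [y = (x + y^2) / 2], and on the ball of radius [q := cnorm x] this map is a
    contraction of ratio [q], because [y^2 - z^2 = y (y - z) + (y - z) z]. *)
Lemma one_minus_square x : star x = x -> cnorm x < 1 ->
  exists2 y, star y = y & 1 - x = y * y.
Proof.
move=> xx x1; set q := cnorm x in x1.
have q_ge0 : 0 <= q := cnorm_ge0 x.
pose h : C := (2^-1 : R)%:C.
pose T y := h *: (x + y * y).
have Nh y : cnorm (h *: y) = 2^-1 * cnorm y by rewrite cnormZr ger0_norm ?invr_ge0.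
have T_lip y z (r : R) : cnorm y <= r -> cnorm z <= r ->
      cnorm (T y - T z) <= r * cnorm (y - z).
  move=> yr zr; rewrite /T -scalerBr Nh opprD addrACA subrr add0r.
  have -> : y * y - z * z = y * (y - z) + (y - z) * z.
    by rewrite mulrBr mulrBl addrA subrK.
  rewrite mulrC ler_pdivrMr // (le_trans (cnormD _ _)) //.
  rewrite mulr_natr mulr2n lerD // (le_trans (cnormM _ _)) //.
    by rewrite ler_wpM2r ?cnorm_ge0.
  by rewrite [_ * cnorm z]mulrC ler_wpM2r ?cnorm_ge0.
pose u n := iter n T 0.
have u_le n : cnorm (u n) <= q.
  elim: n => [|n IHn]; first by rewrite cnorm0.
  rewrite /u iterS -/(u n) /T Nh mulrC ler_pdivrMr // (le_trans (cnormD _ _)) //.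
  rewrite mulr_natr mulr2n lerD // (le_trans (cnormM _ _)) //.
  apply: le_trans (ler_pM (cnorm_ge0 _) (cnorm_ge0 _) IHn IHn) _.
  by rewrite ler_piMr // ltW.
have u_dist n i j : cnorm (u (n + i)%N - u (n + j)%N) <= q ^+ n * 2.
  elim: n => [|n IHn].
    have u1 m : cnorm (u m) <= 1 := le_trans (u_le m) (ltW x1).
    by rewrite expr0 mul1r (le_trans (cnormB _ _)) // -[2]/(1 + 1) lerD.
  rewrite !addSn /u !iterS -/(u _) -/(u _) (le_trans (T_lip _ _ q _ _)) //.
  by rewrite exprS -mulrA ler_wpM2l.
have q_small (e : R) : 0 < e -> exists n, q ^+ n * 2 < e.
  move=> e_gt0.
  have /cvgrPdist_lt/(_ (e / 2)) : (fun n => q ^+ n) @ \oo --> (0 : R).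
    by apply: cvg_expr; rewrite ger0_norm.
  case=> [|n _ /(_ n (leqnn n))]; first by rewrite divr_gt0.
  rewrite sub0r normrN ger0_norm ?exprn_ge0 // => qe; exists n.
  by rewrite -ltr_pdivlMr.
have [e e_gt0|y y_lim] := @cnorm_complete R B u.
  have [n qn] := q_small e e_gt0; exists n => i j ni nj.
  by rewrite -(subnKC ni) -(subnKC nj) (le_lt_trans (u_dist _ _ _)).
have yP e : 0 < e -> exists n, cnorm (u n - y) < e /\ cnorm (u n.+1 - y) < e.
  move=> e_gt0; move/cvgrPdist_lt: y_lim => /(_ e e_gt0)[n _ nP].
  by exists n; split; [have := nP n (leqnn n)|have := nP n.+1 (leqnSn n)];
    rewrite sub0r normrN ger0_norm ?cnorm_ge0.
have star_u n : star (u n) = u n.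
  elim: n => [|n IHn]; first exact: star0.
  rewrite /u iterS -/(u n) /T starZ starD starM IHn xx.
  by congr (_ *: _); exact: conjc_real.
have y_le : cnorm y <= q.
  rewrite -subr_le0; apply: (@le0_approx _ _ 1) => e /yP[n [ne _]].
  rewrite mul1r lerBlDl -[y](subKr (u n)) (le_trans (cnormB _ _)) // lerD //.
  exact: ltW.
have yy : star y = y.
  apply: (@cnorm_eq_approx _ _ 2) => e /yP[n [ne _]].
  apply: le_trans (cnorm_dist (u n) _ _) _.
  rewrite -{1}star_u -starN -starD cnorm_star cnorm_distC.
  by rewrite mulr_natl mulr2n lerD // ltW.
(* The iterates converge to the fixed point, which is hermitian as they are. *)
have yT : T y = y.
  apply: (@cnorm_eq_approx _ _ (q + 1)) => e /yP[n [ne neS]].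
  apply: le_trans (cnorm_dist (u n.+1) _ _) _; rewrite mulrDl mul1r lerD //; last exact: ltW.
  rewrite /u iterS -/(u n) (le_trans (T_lip _ _ q _ _)) // ler_wpM2l // cnorm_distC.
  exact: ltW.
exists (1 - y); first by rewrite starD starN star1 yy.
have xE : x = y *+ 2 - y * y.
  apply/eqP; rewrite eq_sym subr_eq eq_sym; apply/eqP.
  rewrite -[y in RHS]yT /T -scaler_nat scalerA.
  have -> : 2%:R * h = 1 by rewrite /h fmorphV rmorph_nat divff ?pnatr_eq0.
  by rewrite scale1r.
rewrite {}xE mulrBl mul1r mulrBr mulr1 mulr2n !opprB.
by rewrite opprD -[RHS]addrA; congr (_ + _); rewrite addrCA.
Qed.

(** For a hermitian [x] of norm less than 1, both [1 - x] and [1 + x] are of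
    the form [y^* y], so that positivity gives [-1 <= phi x <= 1]. The factor 2 comes
    from splitting into hermitian parts. *)
Lemma state_bound (phi : B -> C) a : is_state phi -> `|phi a| <= (2 * cnorm a)%:C.
Proof.
move=> [phi_lin phi_ge0 phi1]; apply: (hermitian_bound (st := @star R B)) => //.
- exact: cnormD.
- exact: cnormZ.
- exact: cnorm_star.
- exact: starK.
- exact: starD.
- exact: starZ.
move=> x xx.
have phiD u v : phi (u + v) = phi u + phi v by have := phi_lin 1 u v; rewrite scale1r mul1r.
have phi0 : phi 0 = 0 by apply: (addIr (phi 0)); rewrite -phiD !add0r.
have phiZ c u : phi (c *: u) = c * phi u by have := phi_lin c u 0; rewrite !addr0 phi0 addr0.
have le1 y : star y = y -> cnorm y < 1 -> phi y <= 1.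
  move=> yy /(one_minus_square yy)[z zz yE].
  have := phi_ge0 z; rewrite zz -yE phiD phi1 -scaleN1r phiZ mulN1r.
  by rewrite subr_ge0.
have norm1 y : star y = y -> cnorm y < 1 -> `|phi y| <= 1.
  move=> yy y1; have py := le1 y yy y1.
  rewrite real_ler_norml ?ler1_real // py andbT lerNl -mulN1r -phiZ scaleN1r.
  by apply: le1; rewrite ?starN ?yy ?cnormN.
have [r r_ge0 rE] := normcP (phi x); rewrite rE lecR -subr_le0.
apply: (@le0_approx _ _ 1) => e e_gt0; rewrite mul1r lerBlDl.
set t := cnorm x + e; have t_gt0 : 0 < t by rewrite ltr_wpDl ?cnorm_ge0.
have := norm1 ((t^-1)%:C *: x).
rewrite phiZ normrM rE normc_real -rmorphM lecR cnormZr.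
rewrite gtr0_norm ?invr_gt0 // ![t^-1 * _]mulrC ler_pdivrMr // ltr_pdivrMr // !mul1r.
apply; last by rewrite ltrDl.
by rewrite starZ xx; congr (_ *: _); exact: conjc_real.
Qed.

(** McShane's formula: [g b] is the infimum over [t] of
    [F t + c * cnorm (b - j t)]. The bound at [b = j t] forces [g (j t) = F t], so
    [g] extends [F] from the range of [j]. Choosing an infimum rather than a limit
    of approximations makes the extension a function of [b] at once. *)
Lemma lipschitz_extension (T : Type) (t0 : T) (j : T -> B) (F : T -> R) (c : R) : 0 <= c ->
  (forall s t, `|F s - F t| <= c * cnorm (j s - j t)) ->
  exists g : B -> R, forall b t, `|g b - F t| <= c * cnorm (b - j t).
Proof.
move=> c_ge0 Fc.
pose E b := [set F t + c * cnorm (b - j t) | t in [set: T]].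
have lb b t : lbound (E b) (F t - c * cnorm (b - j t)).
  move=> _ [s _ <-]; rewrite lerBlDr -addrA -lerBlDl -mulrDr.
  apply: le_trans (ler_norm _) _; apply: le_trans (Fc _ _) _.
  by rewrite ler_wpM2l // [leRHS]addrC (cnorm_distC b (j t)) cnorm_dist.
exists (fun b => inf (E b)) => b t; rewrite ler_distl; apply/andP; split.
  by apply: lb_le_inf; [exists (F t0 + c * cnorm (b - j t0)); exists t0 | exact: lb].
by apply: ge_inf; [exists (F t - c * cnorm (b - j t)); exact: lb | exists t].
Qed.

Lemma lipschitz_extensionC (T : Type) (t0 : T) (j : T -> B) (F : T -> C) (c : R) : 0 <= c ->
  (forall s t, `|F s - F t| <= (c * cnorm (j s - j t))%:C) ->
  exists g : B -> C, forall b t, `|g b - F t| <= (2 * c * cnorm (b - j t))%:C.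
Proof.
move=> c_ge0 Fc.
have [g1 g1P] : exists g : B -> R, forall b t,
      `|g b - complex.Re (F t)| <= c * cnorm (b - j t).
  apply: (lipschitz_extension t0) => // s t; rewrite -lecR; apply: le_trans (Fc s t).
  by rewrite -raddfB normc_ge_Re.
have [g2 g2P] : exists g : B -> R, forall b t,
      `|g b - complex.Im (F t)| <= c * cnorm (b - j t).
  apply: (lipschitz_extension t0) => // s t; rewrite -lecR; apply: le_trans (Fc s t).
  by rewrite -raddfB normc_ge_Im.
exists (fun b => Complex (g1 b) (g2 b)) => b t.
apply: le_trans (normc_le_ReIm _) _; rewrite lecR !raddfB /=.
by rewrite -mulrA mulr_natl mulr2n lerD.
Qed.

End CstarAlgebras.

(** * The limit state *)

Section LimitState.
Variables (R : realType) (d k : nat).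
Local Notation C := R[i].
Local Notation op := (op R d).
Local Notation Lam := (Lambda k).
Variable B : cstarAlgebra R.
Variable iota : forall X : {fset vertex k}, op X -> B.
Hypothesis iota_lim : is_cstar_limit (@iota).

Lemma iota0 X : iota (0 : op X) = 0.
Proof.
apply: (addIr (iota (0 : op X))).
by have := iota_linear iota_lim 1 (0 : op X) 0; rewrite !scale1r addr0 add0r => {1}<-.
Qed.

Lemma iotaZ X (c : C) (a : op X) : iota (c *: a) = c *: iota a.
Proof. by have := iota_linear iota_lim c a 0; rewrite !addr0 iota0 addr0. Qed.

Lemma iotaD X (a b : op X) : iota (a + b) = iota a + iota b.
Proof. by have := iota_linear iota_lim 1 a b; rewrite !scale1r. Qed.

Lemma iotaB X (a b : op X) : iota (a - b) = iota a - iota b.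
Proof. by rewrite iotaD -scaleN1r iotaZ scaleN1r. Qed.

(** For a hermitian [a] with spectral projections [p i], the equation
    [a * p i = l i *: p i] and [iota (p i) <> 0] give [|l i| <= cnorm (iota a)], so
    the average [f a] of the [l i] is at most [cnorm (iota a)]. Injectivity of
    [iota] is thus all that is needed to compare with the norm of the limit. *)
Lemma local_state_bound X (f : op X -> C) : scalar f ->
  (forall a, 0 <= f (adj a * a)) -> f 1 = 1 ->
  forall a, `|f a| <= (2 * cnorm (iota a))%:C.
Proof.
move=> f_lin f_ge0 f1 a.
apply: (hermitian_bound (N := fun a => cnorm (iota a)) (st := @adj R d k X)) => //.
- by move=> b c; rewrite iotaD cnormD.
- by move=> c b; rewrite iotaZ cnormZ.
- by move=> b; rewrite (iota_adj iota_lim) cnorm_star.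
- exact: adjK.
- exact: adjD.
- exact: adjZ.
move=> {}a /spectral_decomposition[l [p [aE p1 p0 pp ap]]].
have fD u v : f (u + v) = f u + f v by have := f_lin 1 u v; rewrite scale1r mul1r.
have f0 : f 0 = 0 by apply: (addIr (f 0)); rewrite -fD !add0r.
have fZ c u : f (c *: u) = c * f u by have := f_lin c u 0; rewrite !addr0 f0 addr0.
have l_le i : `|l i| <= cnorm (iota a).
  have p_gt0 : 0 < cnorm (iota (p i)).
    rewrite lt_def cnorm_ge0 andbT; apply/eqP => /cnorm0_eq0 ip0; apply: (p0 i).
    by apply: (iota_inj iota_lim); rewrite ip0 iota0.
  rewrite -(ler_pM2r p_gt0) -cnormZr -iotaZ -ap (iotaM iota_lim).
  exact: cnormM.
have fp_ge0 i : 0 <= f (p i) by rewrite -pp.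
rewrite {1}aE (big_morph f fD f0) (le_trans (ler_norm_sum _ _ _)) //.
rewrite -[leRHS]mulr1 -f1 -p1 (big_morph f fD f0) mulr_sumr; apply: ler_sum => i _.
rewrite fZ normrM normc_real (ger0_norm (fp_ge0 i)) ler_wpM2r // lecR.
exact: l_le.
Qed.

Lemma sub_Lambda (X : {fset vertex k}) : exists n, X `<=` Lam n.
Proof.
exists (\max_(x <- X) size x); apply/fsubsetP => x xX.
by rewrite mem_Lambda (leq_bigmax_seq _ xX).
Qed.

Lemma Lambda_dense (b : B) (e : R) : 0 < e ->
  exists n (a : op (Lam n)), cnorm (b - iota a) < e.
Proof.
move=> e_gt0; have [X [a ae]] := iota_dense iota_lim b e_gt0.
have [n Xn] := sub_Lambda X.
by exists n, (embed (Lam n) a); rewrite (iota_embed iota_lim).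
Qed.

Variable f : forall n, op (Lam n) -> C.
Hypothesis f_scalar : forall n, scalar (@f n).
Hypothesis f_ge0 : forall n (a : op (Lam n)), 0 <= f (adj a * a).
Hypothesis f1 : forall n, f (1 : op (Lam n)) = 1.
Hypothesis f_embed : forall m n (a : op (Lam m)), f (embed (Lam (m + n)) a) = f a.

Lemma f_embed_le m n (a : op (Lam m)) : (m <= n)%N -> f (embed (Lam n) a) = f a.
Proof. by move=> /subnKC <-; exact: f_embed. Qed.

Lemma common_level m n (a : op (Lam m)) (b : op (Lam n)) :
  exists l (a' b' : op (Lam l)),
  [/\ iota a' = iota a, iota b' = iota b, f a' = f a & f b' = f b].
Proof.
exists (maxn m n), (embed _ a), (embed _ b).
have ml := leq_maxl m n; have nl := leq_maxr m n.
by split; rewrite ?(iota_embed iota_lim) ?f_embed_le //; exact: Lambda_mono.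
Qed.

Lemma f_linear n (c : C) (a b : op (Lam n)) : f (c *: a + b) = c * f a + f b.
Proof. exact: f_scalar. Qed.

Lemma f_sub n (a b : op (Lam n)) : f (a - b) = f a - f b.
Proof. by rewrite addrC -scaleN1r f_linear mulN1r addrC. Qed.

Lemma f_lipschitz m n (a : op (Lam m)) (b : op (Lam n)) :
  `|f a - f b| <= (2 * cnorm (iota a - iota b))%:C.
Proof.
have [l [a' [b' [<- <- <- <-]]]] := common_level a b.
by rewrite -f_sub -iotaB; apply: local_state_bound.
Qed.

(** The local functionals form one Lipschitz function on the dense union of
    the local algebras; the constant is [2 * 2], from [local_state_bound] and from
    extending real and imaginary parts separately. *)
Lemma limit_functional : exists phi : B -> C,
  forall b n (a : op (Lam n)), `|phi b - f a| <= (4 * cnorm (b - iota a))%:C.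
Proof.
pose T := {n : nat & op (Lam n)}.
have [phi phiP] := @lipschitz_extensionC R B T (existT _ 0%N (0 : op (Lam 0)))
  (fun t => iota (tagged t)) (fun t => f (tagged t)) 2 (ler0n _ _)
  (fun s t => f_lipschitz (tagged s) (tagged t)).
exists phi => b n a; have := phiP b (Tagged (fun n => op (Lam n)) a).
by rewrite -natrM.
Qed.

(** Linearity and positivity hold on the dense union, and pass to [phi] because
    [phi] is uniformly close to [f] there. *)
Lemma limit_state : exists2 phi : B -> C, is_state phi &
  forall n (a : op (Lam n)), phi (iota a) = f a.
Proof.
have [phi phiP] := limit_functional.
have phi_iota n (a : op (Lam n)) : phi (iota a) = f a.
  apply: (@eq_approx _ _ _ 0) => e _.
  by rewrite mul0r (le_trans (phiP _ _ a)) // subrr cnorm0 mulr0.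
exists phi => //; split.
- move=> c b b'.
  have [r r_ge0 cE] := normcP c.
  apply: (@eq_approx _ _ _ (4 * (r + 1) + (r * 4 + 4))) => e e_gt0.
  have [m [a0 ae0]] := Lambda_dense b e_gt0.
  have [n [a0' ae0']] := Lambda_dense b' e_gt0.
  have [l [a [a' [aE aE' _ _]]]] := common_level a0 a0'.
  rewrite -aE in ae0; rewrite -aE' in ae0'.
  have near x (y : op (Lam l)) : cnorm (x - iota y) < e -> `|phi x - f y| <= (4 * e)%:C.
    by move=> /ltW xy; rewrite (le_trans (phiP _ _ _)) // lecR ler_wpM2l.
  rewrite -[X in `|X|](subrKA (f (c *: a + a'))) (le_trans (ler_normD _ _)) //.
  rewrite mulrDl rmorphD lerD //.
    rewrite (le_trans (phiP _ _ _)) // lecR -mulrA ler_wpM2l // iotaD iotaZ.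
    have -> : c *: b + b' - (c *: iota a + iota a') = c *: (b - iota a) + (b' - iota a').
      by rewrite scalerBr opprD addrACA.
    rewrite (le_trans (cnormD _ _)) // mulrDl mul1r lerD ?(ltW ae0') //.
    by rewrite -lecR cnormZ cE rmorphM ler_wpM2l ?lecR ?(ltW ae0) // -cE.
  rewrite f_linear opprD addrACA -mulrBr (le_trans (ler_normD _ _)) //.
  rewrite mulrDl rmorphD lerD //; last by rewrite distrC near.
  by rewrite normrM cE -mulrA rmorphM ler_wpM2l ?ler0c // distrC near.
- move=> b; apply: (@ge0_approx _ _ (4 * (cnorm b + (cnorm b + 1)))) => e e_gt0.
  (* The cap at 1 bounds the norm of [a], hence the error of [a^* a], linearly in [e]. *)
  have e'_gt0 : 0 < Num.min e 1 by rewrite lt_min e_gt0 ltr01.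
  have [n [a ae]] := Lambda_dense b e'_gt0.
  move: ae; rewrite lt_min => /andP[/ltW ae a1].
  exists (f (adj a * a)); first exact: f_ge0.
  rewrite (le_trans (phiP _ _ _)) // lecR -mulrA ler_wpM2l //.
  rewrite (iotaM iota_lim) (iota_adj iota_lim).
  apply: le_trans (cnorm_dist (star b * iota a) _ _) _.
  rewrite -mulrBr -mulrBl [leRHS]mulrDl lerD // (le_trans (cnormM _ _)) //.
    by rewrite cnorm_star ler_wpM2l ?cnorm_ge0.
  rewrite -starN -starD cnorm_star mulrC ler_pM ?cnorm_ge0 //.
  rewrite -[iota a](subKr b) (le_trans (cnormB _ _)) // lerD2l ltW //.
- by rewrite -(iota1 iota_lim (Lam 0)) phi_iota f1.
Qed.

(** Positivity alone makes a state continuous ([state_bound]), so it is determined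
    by its values on a dense set. *)
Lemma state_unique (phi psi : B -> C) : is_state phi -> is_state psi ->
  (forall n (a : op (Lam n)), phi (iota a) = f a) ->
  (forall n (a : op (Lam n)), psi (iota a) = f a) -> phi = psi.
Proof.
move=> phiS psiS phif psif; apply/funext => b.
apply: (@eq_approx _ _ _ 4) => e /(Lambda_dense b)[n [a /ltW ae]].
have split_a (g : B -> C) : is_state g ->
    (forall n (a : op (Lam n)), g (iota a) = f a) -> g b = g (b - iota a) + f a.
  by move=> [lin _ _] gf; rewrite [b - _]addrC -scaleN1r lin gf mulN1r addrAC addNr add0r.
rewrite (split_a _ phiS phif) (split_a _ psiS psif) opprD addrACA subrr addr0.
rewrite (le_trans (ler_normB _ _)) //.
have le g : is_state g -> `|g (b - iota a)| <= (2 * e)%:C.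
  by move=> gS; rewrite (le_trans (state_bound _ gS)) // lecR ler_wpM2l.
rewrite (le_trans (lerD (le _ phiS) (le _ psiS))) // -rmorphD lecR -mulrDl.
by rewrite -natrD.
Qed.

(** By compatibility the sequences in the definition of the weak limit are
    constant. *)
Lemma wlimP (phi : B -> C) :
  is_wlim (@iota) f phi <-> forall n (a : op (Lam n)), phi (iota a) = f a.
Proof.
have E m (a : op (Lam m)) : (fun n => f (embed (Lam (m + n)) a)) = cst (f a).
  by apply/funext => n; rewrite f_embed.
split=> [lim n a|phif m a]; last first.
  by rewrite phif E; exact: (@cvg_cst R[i]^o (f a) nat \oo _).
have := lim n a; rewrite E => cv.
exact: (cvg_unique (@norm_hausdorff C C^o) cv (@cvg_cst C^o (f a) nat \oo _)).
Qed.

End LimitState.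

Theorem theorem6p1 (R : realType) (k d : nat) (k_gt0 : (0 < k)%N)
    (K : forall (x : vertex k) (i : 'I_k), op R d (edge x i))
    (w0 : op R d [fset x0 k])
    (h : forall x : vertex k, op R d [fset x])
    (w0_ge0 : positive_op w0)
    (h_ge0 : forall x : vertex k, positive_op (h x))
    (w0h : ntr (w0 * h (x0 k)) = 1)
    (Kh : forall x : vertex k, consistent K h x) :
  (forall (n : nat) (a : op R d (Lambda k n)),
     phin K w0 h (embed (Lambda k n.+1) a) = phin K w0 h a) /\
  (forall (B : cstarAlgebra R)
          (iota : forall X : {fset vertex k}, op R d X -> B),
     is_cstar_limit iota ->
     exists! phi : B -> R[i],
       is_state phi /\ is_wlim iota (fun n => @phin R d k K w0 h n) phi).
Proof.
split; first by move=> n a; exact: phin_compatible.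
move=> B iota iota_lim.
have f_embed := phin_compatible_add w0_ge0 h_ge0 Kh.
have f1 n := phin1 w0_ge0 h_ge0 Kh n w0h.
have [phi phiS phif] :=
  limit_state iota_lim (phin_scalar K w0 h) (@phin_ge0 _ _ _ K w0 h) f1 f_embed.
exists phi; split; first by split=> //; apply/(wlimP _ f_embed).
move=> psi [psiS /(wlimP _ f_embed) psif].
exact: (state_unique iota_lim phiS psiS phif psif).
Qed.
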